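(* Let $M$ be any left $\Lambda$-module, not necessarily finitely generated. The following are equivalent: (i) $M$ has finite projective dimension; (ii) $M/\varepsilon J M$ is a direct sum of copies of the local modules $\mathcal{A}_1,\dots,\mathcal{A}_n$; (iii) for a projective cover $f:P\to M$, all simple composition factors of $\operatorname{Ker}(f)$ are non-precyclic.
   Context: Let $K$ be a field, $Q$ a finite quiver whose vertices are identified with primitive idempotents $e_1,\dots,e_n$, $L\ge1$, and $\Lambda=KQ/I$ the truncated path algebra, $I$ generated by all paths of length $L+1$; $J$ is the Jacobson radical of $\Lambda$, and $S_i=\Lambda e_i/Je_i$. Paths are multiplied so that $pq$ means ''$p$ after $q$''. A vertex $e_i$ (and the simple $S_i$) is called precyclic if there is a path (possibly of length $0$) in $Q$ starting at $e_i$ and ending at a vertex lying on an oriented cycle. Let $\varepsilon$ be the sum of the idempotents $e_i$ corresponding to the non-precyclic vertices; for any left $\Lambda$-module $M$, $\varepsilon M$ is a submodule. Set $\mathcal{A}_i=\Lambda e_i/\varepsilon J e_i$ for $1\le i\le n$. *)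

(* Defs.v *)
From HB Require Import structures.
From mathcomp Require Import all_boot all_order all_algebra.
From Stdlib Require Import ClassicalEpsilon.
Unset Printing Implicit Defensive.
Import GRing.Theory.
Local Open Scope ring_scope.

(* Conventions.
   The quiver Q has vertex set 'I_n (vertex i <-> idempotent e_i) and a finite
   type A of arrows, arrow a going from [src a] to [tgt a].
   A word [:: a1; ...; ak] : seq A stands for the path ak ... a1
   ("pq = p after q"), i.e. a1 is traversed first.
   Lambda = KQ / (paths of length L+1).  A left Lambda-module is described by
   its underlying K-vector space together with the (K-linear) actions of the
   generators e_i and a of Lambda, subject to the defining relations of
   Lambda (see [is_mod]); this is exactly the data of a left Lambda-module,
   not necessarily finitely generated. *)

Definition surj {X Y : Type} (f : X -> Y) : Prop := forall y, exists x, f x = y.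

Section TruncatedPathAlgebra.
Variables (K : fieldType) (n : nat) (A : finType) (src tgt : A -> 'I_n) (L : nat).

Definition walkb (i : 'I_n) (w : seq A) : bool :=
  if w is a :: _ then (src a == i) && sorted (fun a b => tgt a == src b) w
  else true.

Definition endv (i : 'I_n) (w : seq A) : 'I_n := last i [seq tgt a | a <- w].

Definition walk (i : 'I_n) (w : seq A) (j : 'I_n) : Prop :=
  walkb i w /\ endv i w = j.

Definition on_cycle (j : 'I_n) : Prop :=
  exists w : seq A, w <> [::] /\ walk j w j.

Definition precyclic (i : 'I_n) : Prop :=
  exists (w : seq A) (j : 'I_n), walk i w j /\ on_cycle j.

Definition precycb (i : 'I_n) : bool :=
  if excluded_middle_informative (precyclic i) then true else false.

Record modData := ModData {
  carrier :> lmodType K;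
  idem : 'I_n -> carrier -> carrier;
  arr  : A -> carrier -> carrier
}.

Definition islin {M N : lmodType K} (f : M -> N) : Prop :=
  forall (c : K) (x y : M), f (c *: x + y) = c *: f x + f y.

Definition pathact (M : modData) (w : seq A) (x : M) : M :=
  foldl (fun y a => arr M a y) x w.

Definition is_mod (M : modData) : Prop :=
  [/\ (forall i, islin (idem M i)),
      (forall a, islin (arr M a)),
      (forall x : M, \sum_(i < n) idem M i x = x),
      (forall i j (x : M), idem M i (idem M j x) = if i == j then idem M j x else 0) &
    [/\ (forall a (x : M), arr M a (idem M (src a) x) = arr M a x),
        (forall a (x : M), idem M (tgt a) (arr M a x) = arr M a x) &
        (forall (w : seq A) (x : M), size w = L.+1 -> pathact M w x = 0)]].

Definition is_hom {M N : modData} (f : M -> N) : Prop :=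
  [/\ islin f,
      (forall i x, f (idem M i x) = idem N i (f x)) &
      (forall a x, f (arr M a x) = arr N a (f x))].

Definition hom_on {M N : modData} (U : M -> Prop) (f : M -> N) : Prop :=
  [/\ (forall c x y, U x -> U y -> f (c *: x + y) = c *: f x + f y),
      (forall i x, U x -> f (idem M i x) = idem N i (f x)) &
      (forall a x, U x -> f (arr M a x) = arr N a (f x))].

Definition submod {M : modData} (U : M -> Prop) : Prop :=
  [/\ U 0,
      (forall c x y, U x -> U y -> U (c *: x + y)),
      (forall i x, U x -> U (idem M i x)) &
      (forall a x, U x -> U (arr M a x))].

Definition projective (P : modData) : Prop :=
  forall (X Y : modData) (g : X -> Y) (h : P -> Y),
    is_mod X -> is_mod Y -> is_hom g -> surj g -> is_hom h ->
    exists k : P -> X, is_hom k /\ forall x, g (k x) = h x.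

Inductive pd_le : nat -> modData -> Prop :=
  | pd_proj k (M : modData) : projective M -> pd_le k M
  | pd_step k (M P Z : modData) (f : P -> M) (g : Z -> P) :
      is_mod P -> is_mod Z -> projective P ->
      is_hom f -> surj f -> is_hom g -> injective g ->
      (forall x, f x = 0 <-> exists z, g z = x) ->
      pd_le k Z -> pd_le k.+1 M.

Definition fin_pd (M : modData) : Prop := exists k, pd_le k M.

(* J M : elements sum_k c_k p_k m_k with p_k paths of length >= 1
   (J = rad Lambda is spanned by the paths of positive length) *)
Definition radJ (M : modData) (x : M) : Prop :=
  exists s : seq (seq A * K * M),
    (forall t, t \in s -> t.1.1 != [::]) /\
    x = \sum_(t <- s) t.1.2 *: pathact M t.1.1 t.2.

Definition epsact (M : modData) (x : M) : M :=
  \sum_(j < n | ~~ precycb j) idem M j x.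

Definition epsJ (M : modData) (x : M) : Prop :=
  exists y, radJ M y /\ x = epsact M y.

Definition proj_cover {P M : modData} (f : P -> M) : Prop :=
  [/\ is_mod P, projective P, is_hom f, surj f &
      forall U : P -> Prop, submod U ->
        (forall x, exists u k, U u /\ f k = 0 /\ x = u + k) -> forall x, U x].

Fixpoint allwords (k : nat) : seq (seq A) :=
  if k is k'.+1 then [::] :: [seq a :: w | a <- enum A, w <- allwords k']
  else [:: [::]].

(* paths starting at i of length <= L: a K-basis of Lambda e_i *)
Definition pathsFrom (i : 'I_n) : seq (seq A) :=
  [seq w <- allwords L | walkb i w].

Definition PW (i : 'I_n) := seq_sub (pathsFrom i).

Definition lastA (w : seq A) : option A := ohead (rev w).
Definition dropLast (w : seq A) : seq A := take (size w).-1 w.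

Definition LamE_idem (i : 'I_n) (j : 'I_n) (f : {ffun PW i -> K^o})
  : {ffun PW i -> K^o} :=
  [ffun w : PW i => if endv i (ssval w) == j then f w else 0].

Definition LamE_arr (i : 'I_n) (a : A) (f : {ffun PW i -> K^o})
  : {ffun PW i -> K^o} :=
  [ffun w : PW i =>
     if lastA (ssval w) == Some a then
       (if insub (dropLast (ssval w)) is Some w' then f w' else 0)
     else 0].

Definition LamE (i : 'I_n) : modData :=
  @ModData {ffun PW i -> K^o} (@LamE_idem i) (@LamE_arr i).

(* U / V ≅ Lambda e_i / J e_i = S_i, for submodules V <= U of P *)
Definition comp_factor {P : modData} (N : P -> Prop) (i : 'I_n) : Prop :=
  exists U V : P -> Prop,
    [/\ submod U, submod V, (forall x, V x -> U x), (forall x, U x -> N x) &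
    exists (X : modData) (phi : P -> X) (psi : LamE i -> X),
      [/\ is_mod X, hom_on U phi,
          (forall y, exists x, U x /\ phi x = y),
          (forall x, U x -> (phi x = 0 <-> V x)) &
          [/\ is_hom psi, surj psi &
              forall z, psi z = 0 <-> radJ (LamE i) z]]].

(* M / epsilon J M is a direct sum of copies of the A_i = Lambda e_i / epsilon J e_i *)
Definition dsum_copies (M : modData) : Prop :=
  exists (X : modData) (phi : M -> X),
    [/\ is_mod X, is_hom phi, surj phi,
        (forall x, phi x = 0 <-> epsJ M x) &
    exists (T : eqType) (c : T -> 'I_n) (U : T -> X -> Prop),
      [/\ (forall t, submod (U t)),
          (forall t, exists psi : LamE (c t) -> X,
              [/\ is_hom psi,
                  (forall y, U t y <-> exists z, psi z = y) &
                  (forall z, psi z = 0 <-> epsJ (LamE (c t)) z)]),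
          (forall x : X, exists s : seq (T * X),
              (forall p, p \in s -> U p.1 p.2) /\ x = \sum_(p <- s) p.2) &
          (forall s : seq (T * X), uniq [seq p.1 | p <- s] ->
              (forall p, p \in s -> U p.1 p.2) -> \sum_(p <- s) p.2 = 0 ->
              forall p, p \in s -> p.2 = 0)]].

Definition kernel_nonprecyclic (M : modData) : Prop :=
  forall (P : modData) (f : P -> M), proj_cover f ->
    forall i, comp_factor (fun x => f x = 0) i -> ~ precyclic i.

End TruncatedPathAlgebra.

(* Main.v *)
(* A vertex with an arrow to a precyclic vertex is precyclic, so J^L has, from every
   precyclic vertex, a nonzero component ending at a precyclic vertex.  Call M good
   if sum_u u m_u = 0 at a precyclic vertex, u ranging over the paths of one length
   k <= L, forces every m_u into JM.  Free modules, their direct summands and the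
   modules A_i are good, and in an exact sequence 0 -> Z -> P -> M -> 0 with P
   and Z good, M is good; hence finite projective dimension implies good, and so does
   (ii).  If M is good and the kernel of P -> M lies in JP, then that kernel vanishes at
   every precyclic vertex: this is (iii), and a basis of M/JM yields the decomposition
   (ii).  Finally a module living on nonprecyclic vertices has finite projective
   dimension, because the support of the syzygies moves along an acyclic quiver. *)
Require Import Defs.
From HB Require Import structures.
From mathcomp Require Import all_boot all_order all_algebra.
From mathcomp Require Import boolp classical_sets functions.
Set Implicit Arguments. Unset Strict Implicit. Unset Printing Implicit Defensive.
Import GRing.Theory.
Local Open Scope ring_scope.

(** Nonprecyclic vertices are closed under successors, so passing from M to M/(epsilon M) is exact
    and sends projectives to projectives over Lambda/(Lambda epsilon Lambda), the truncated path
    algebra of the full subquiver on the precyclic vertices. There every vertex is the source of an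
    arrow, which forces finitistic dimension 0: finite projective dimension over that algebra means
    projective. Goodness phrases this projectivity through elements of M, so neither the quotient
    algebra nor Tor has to be built. *)

Lemma sum_regroup (I : Type) (T : eqType) (W : zmodType) (s : seq I) (k : I -> T)
    (F : I -> W) (ts : seq T) :
  uniq ts -> all (fun p => k p \in ts) s ->
  \sum_(p <- s) F p = \sum_(t <- ts) \sum_(p <- s | k p == t) F p.
Proof.
move=> uts; elim: s => [_|p s IH /= /andP[kp ks]].
  by rewrite big_nil big1_seq // => t _; rewrite big_nil.
rewrite big_cons IH // (bigD1_seq (k p)) //= [RHS](bigD1_seq (k p)) //=.
rewrite big_cons eqxx addrA; congr (_ + _); apply: eq_bigr => t tkp.
by rewrite big_cons eq_sym (negPf tkp).
Qed.

(** * Linear algebra *)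

Section LinearAlgebra.
Variables (K : fieldType) (V : lmodType K).

Definition subspace (U : V -> Prop) : Prop :=
  U 0 /\ forall (c : K) x y, U x -> U y -> U (c *: x + y).

Section Closure.
Variables (U : V -> Prop) (HU : subspace U).

Lemma subspace_add x y : U x -> U y -> U (x + y).
Proof. by move=> Ux Uy; rewrite -[x]scale1r; apply HU. Qed.

Lemma subspace_scale c x : U x -> U (c *: x).
Proof. by move=> Ux; rewrite -[_ *: _]addr0; apply HU => //; apply HU. Qed.

Lemma subspace_opp x : U x -> U (- x).
Proof. by move=> Ux; rewrite -scaleN1r; apply: subspace_scale. Qed.

Lemma subspace_sub x y : U x -> U y -> U (x - y).
Proof. by move=> Ux Uy; apply: subspace_add => //; apply: subspace_opp. Qed.

Lemma subspace_sum (I : Type) (s : seq I) (P : pred I) (F : I -> V) :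
  (forall i, P i -> U (F i)) -> U (\sum_(i <- s | P i) F i).
Proof.
move=> H; elim/big_rec: _ => [|i x Pi Ux]; first exact: HU.1.
by apply: subspace_add => //; apply: H.
Qed.

Lemma subspace_sum_seq (I : eqType) (s : seq I) (F : I -> V) :
  (forall i, i \in s -> U (F i)) -> U (\sum_(i <- s) F i).
Proof. by move=> H; rewrite big_seq; apply: subspace_sum. Qed.

End Closure.

Definition indep_mod (U B : V -> Prop) : Prop :=
  forall (s : seq V) (a : V -> K), uniq s -> (forall b, b \in s -> B b) ->
    U (\sum_(b <- s) a b *: b) -> forall b, b \in s -> a b = 0.

Definition spanned (B : V -> Prop) (x : V) : Prop :=
  exists s : seq (K * V),
    (forall p, p \in s -> B p.2) /\ x = \sum_(p <- s) p.1 *: p.2.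

Lemma subspace_spanned B : subspace (spanned B).
Proof.
split; first by exists [::]; rewrite big_nil.
move=> c x y [s [Bs ->]] [t [Bt ->]].
exists ([seq (c * p.1, p.2) | p <- s] ++ t); split.
  by move=> p; rewrite mem_cat => /orP[/mapP[q qs ->] /=|]; [apply: Bs|apply: Bt].
rewrite big_cat big_map scaler_sumr; congr (_ + _).
by apply: eq_bigr => p _ /=; rewrite scalerA.
Qed.

Lemma spanned_self (B : V -> Prop) b : B b -> spanned B b.
Proof.
move=> Bb; exists [:: (1, b)]; rewrite big_seq1 scale1r; split => // p.
by rewrite inE => /eqP ->.
Qed.

Lemma indep_mod_spanned U B x : indep_mod U B -> spanned B x -> U x -> x = 0.
Proof.
move=> iB [s [Bs xE]] Ux; set ts := undup [seq p.2 | p <- s].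
have E : x = \sum_(b <- ts) (\sum_(p <- s | p.2 == b) p.1) *: b.
  rewrite xE (@sum_regroup _ _ _ s snd _ ts) ?undup_uniq //.
    by apply: eq_bigr => b _; rewrite scaler_suml; apply: eq_bigr => p /eqP ->.
  by apply/allP => p ps; rewrite mem_undup; apply: map_f.
rewrite E big1_seq // => b /andP[_ bts].
rewrite (iB ts (fun b => \sum_(p <- s | p.2 == b) p.1)) ?scale0r ?undup_uniq // -?E //.
by move=> c; rewrite mem_undup => /mapP[p ps ->]; apply: Bs.
Qed.

Lemma indep_mod_family U B (I : eqType) (s : seq I) (b : I -> V) (a : I -> K) :
  indep_mod U B -> uniq [seq b i | i <- s] -> (forall i, i \in s -> B (b i)) ->
  U (\sum_(i <- s) a i *: b i) -> forall i, i \in s -> a i = 0.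
Proof.
move=> iB us Bs Us i si.
pose a' v := a (nth i s (index v [seq b l | l <- s])).
have a'E l : l \in s -> a' (b l) = a l.
  move=> ls; rewrite /a'; congr a; rewrite -[in RHS](nth_index i ls); congr nth.
  rewrite -{1}(nth_index i ls) -(nth_map _ (b i)) ?index_mem //.
  by rewrite index_uniq ?size_map ?index_mem.
rewrite -(a'E i si); apply: (iB [seq b l | l <- s]) => //; last exact: map_f.
  by move=> v /mapP[l ls ->]; apply: Bs.
rewrite big_map; congr U: Us; apply: eq_big_seq => l ls.
by rewrite a'E.
Qed.

(** Zorn's lemma among the subsets of [S] independent modulo [U]. [S] need not be a subspace: with
    the vectors located at a single vertex as [S], the basis of M/JM becomes compatible with the
    idempotents. *)
Lemma exists_basis_mod (U S : V -> Prop) : subspace U ->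
  exists B : V -> Prop, [/\ forall b, B b -> S b, indep_mod U B &
    forall x, S x -> exists2 y, spanned B y & U (x - y)].
Proof.
move=> HU; pose P (B : set V) := (forall b, B b -> S b) /\ indep_mod U B.
have [|B [[BS iB] maxB]] := @Zorn_bigcup V P.
  move=> F FP Ftot; split=> [b [X FX Xb]|]; first exact: (FP X FX).1.
  move=> s a us Bs; have [->|[X FX Xs]] : s = [::] \/ exists2 X, F X & forall b, b \in s -> X b.
  - elim: s {us} Bs => [|b s IH] Bs; [by left|right].
    have [X FX Xb] : (\bigcup_(X in F) X)%classic b by apply: Bs; rewrite mem_head.
    have [c cs|->|[Y FY Ys]] := IH; first by apply: Bs; rewrite inE cs orbT.
      by exists X => // c; rewrite inE => /eqP ->.
    case: (Ftot X Y FX FY) => sub.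
      by exists Y => // c; rewrite inE => /predU1P[->|/Ys //]; apply: sub.
    by exists X => // c; rewrite inE => /predU1P[->//|/Ys]; apply: sub.
  - by [].
  - exact: (FP X FX).2 us Xs.
exists B; split=> // x Sx.
have [Bx|nBx] := pselect (B x).
  by exists x; [apply: spanned_self|rewrite subrr; apply: HU.1].
apply: contrapT => nspan; apply: (maxB (B `|` [set x])%classic).
  by split=> [y By|sub]; [left|apply: nBx; apply: sub; right].
split=> [b [/BS//|->//]|s a us Bxs Us].
have [xs|xs] := boolP (x \in s); last first.
  apply: iB us _ Us => b bs; have [//|bx] := Bxs b bs.
  by rewrite -bx bs in xs.
have Brem b : b \in rem x s -> B b.
  rewrite mem_rem_uniq // inE => /andP[/= bx bs].
  by have [//|/eqP] := Bxs b bs; rewrite (negPf bx).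
move: Us; rewrite (perm_big _ (perm_to_rem xs)) big_cons /= => Us.
(* A nonzero coefficient of [x] would put [x] into the span of [B] modulo [U], so the relation
   involves [B] alone. *)
have [ax0|ax0] := eqVneq (a x) 0; last first.
  case: nspan; exists (- (a x)^-1 *: \sum_(b <- rem x s) a b *: b).
    rewrite scaler_sumr; apply: (subspace_sum_seq (subspace_spanned B)) => b /Brem Bb.
    by rewrite scalerA; apply: subspace_scale (subspace_spanned B) _ _ (spanned_self Bb).
  have -> : x - - (a x)^-1 *: (\sum_(b <- rem x s) a b *: b)
     = (a x)^-1 *: (a x *: x + \sum_(b <- rem x s) a b *: b).
    by rewrite scalerDr scalerA mulVf // scale1r scaleNr opprK.
  exact: subspace_scale.
move: Us; rewrite ax0 scale0r add0r => Us b.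
rewrite (perm_mem (perm_to_rem xs)) inE => /predU1P[->//|].
exact: iB (rem_uniq _ us) Brem Us b.
Qed.

(** Two elements of the span of [B] that are congruent modulo [U] coincide, so the chosen
    representative depends linearly on the vector. *)
Lemma projection_mod_basis (U B : V -> Prop) :
  subspace U -> indep_mod U B -> (forall x, exists2 y, spanned B y & U (x - y)) ->
  exists p : V -> V, [/\ islin K p, forall x, spanned B (p x), forall x, p x = 0 <-> U x,
    forall x, U (x - p x) & forall x, spanned B x -> p x = x].
Proof.
move=> HU iB sB; have [p pP] := choice (fun x => iffLR (exists2P _ _) (sB x)).
have uniqp x y : spanned B y -> U (x - y) -> p x = y.
  move=> By Uxy; apply/eqP; rewrite -subr_eq0; apply/eqP.
  have [Bp Up] := pP x.
  apply: (indep_mod_spanned iB); first exact: (subspace_sub (subspace_spanned B)).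
  have -> : p x - y = (x - y) - (x - p x) by rewrite opprB [RHS]addrC addrA subrK.
  exact: (subspace_sub HU).
exists p; split.
- move=> c x y; apply: uniqp.
    by apply: (subspace_spanned B).2; [exact: (pP x).1|exact: (pP y).1].
  rewrite opprD addrACA -scalerBr; apply: HU.2; [exact: (pP x).2|exact: (pP y).2].
- by move=> x; exact: (pP x).1.
- move=> x; split=> [px0|Ux]; first by have := (pP x).2; rewrite px0 subr0.
  by apply: uniqp; [exact: (subspace_spanned B).1|rewrite subr0].
- by move=> x; exact: (pP x).2.
- by move=> x Bx; apply: uniqp => //; rewrite subrr; exact: HU.1.
Qed.

Lemma exists_projection (U : V -> Prop) : subspace U ->
  exists p : V -> V, [/\ islin K p, forall x, p x = 0 <-> U x & forall x, U (x - p x)].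
Proof.
move=> HU; have [B [_ iB sB]] := exists_basis_mod (fun=> True) HU.
have [p [p1 _ p2 p3 _]] := projection_mod_basis HU iB (fun x => sB x I).
by exists p.
Qed.

Lemma exists_functional (U : V -> Prop) x : subspace U -> ~ U x ->
  exists f : V -> K, [/\ forall c y z, f (c *: y + z) = c * f y + f z,
    forall y, U y -> f y = 0 & f x = 1].
Proof.
(* [U'] is U + Kx. With [p] a projection killing it, [y - p y] lies in U + Kx, and its coefficient
   at [x], unique because [x] is outside [U], is the functional. *)
move=> HU nUx; pose U' y := exists c, U (y - c *: x).
have HU' : subspace U'.
  split=> [|c y z [d Ud] [e Ue]]; first by exists 0; rewrite scale0r subr0; apply: HU.1.
  exists (c * d + e); rewrite scalerDl -scalerA opprD addrACA -scalerBr.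
  exact: HU.2.
have [p [plin p0 pU]] := exists_projection HU'.
have [f fP] := choice pU.
have funiq y c : U (y - p y - c *: x) -> f y = c.
  move=> Uc; apply/eqP; rewrite -subr_eq0; apply/contraT => nz; case: nUx.
  have : U ((f y - c) *: x).
    rewrite scalerBl; have -> : f y *: x - c *: x = (y - p y - c *: x) - (y - p y - f y *: x).
      by rewrite opprB [RHS]addrC addrA subrK.
    exact: (subspace_sub HU).
  by move/(subspace_scale HU (f y - c)^-1); rewrite scalerA mulVf // scale1r.
exists f; split=> [c y z|y Uy|]; apply: funiq.
- rewrite plin opprD addrACA -scalerBr scalerDl -scalerA opprD addrACA -scalerBr.
  by apply: HU.2.
- have -> : p y = 0 by apply/p0; exists 0; rewrite scale0r subr0.
  by rewrite scale0r !subr0.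
- have -> : p x = 0 by apply/p0; exists 1; rewrite scale1r subrr; apply: HU.1.
  by rewrite scale1r subr0 subrr; apply: HU.1.
Qed.

End LinearAlgebra.

(** An arbitrary choice of preimages becomes linear after projection along the kernel of [g], which
    removes its ambiguity. *)
Lemma exists_section (K : fieldType) (X Y : lmodType K) (g : X -> Y) :
  islin K g -> Defs.surj g -> exists s : Y -> X, islin K s /\ cancel s g.
Proof.
move=> glin gsurj; have g0 : g 0 = 0.
  by have := glin (-1) 0 0; rewrite !scaleN1r oppr0 addr0 addNr.
have gB x y : g (x - y) = g x - g y.
  by rewrite addrC -scaleN1r glin scaleN1r addrC.
have HU : subspace (fun x => g x = 0).
  by split=> // c x y gx gy; rewrite glin gx gy scaler0 addr0.
have [p [plin p0 pU]] := exists_projection HU.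
have gp x : g (p x) = g x by apply/esym/eqP; rewrite -subr_eq0 -gB; apply/eqP.
have pB x y : p (x - y) = p x - p y.
  by rewrite addrC -scaleN1r plin scaleN1r addrC.
have [r rK] := choice gsurj.
exists (p \o r); split=> [c x y|y] /=; last by rewrite gp rK.
rewrite -plin; apply/eqP; rewrite -subr_eq0 -pB; apply/eqP/p0.
by rewrite gB glin !rK subrr.
Qed.

Section SubspaceType.
Variables (K : fieldType) (V : lmodType K) (U : V -> Prop) (HU : subspace U).

Definition subspace_pred : pred V := fun x => `[< U x >].

Lemma subspace_predP : subsemimod_closed subspace_pred.
Proof.
split=> [|c x]; last by move=> /asboolP Ux; apply/asboolP/(subspace_scale HU).
split=> [|x y /asboolP Ux /asboolP Uy]; first by apply/asboolP; apply HU.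
by apply/asboolP/(subspace_add HU).
Qed.

(** The [let] retains [HU] as a parameter of the type; the module structure below depends on it. *)
Definition subspace_type := let _ := HU in {x : V | subspace_pred x}.

HB.instance Definition _ := SubType.copy subspace_type {x : V | subspace_pred x}.
HB.instance Definition _ := [Choice of subspace_type by <:].
HB.instance Definition _ :=
  GRing.SubChoice_isSubLmodule.Build K V subspace_pred subspace_type subspace_predP.

End SubspaceType.

Section Linear.
Variables (K : fieldType) (V W : lmodType K) (f : V -> W) (Hf : islin K f).

Lemma islin0 : f 0 = 0.
Proof. by have := Hf (-1) 0 0; rewrite !scaleN1r oppr0 addr0 addNr. Qed.

Lemma islinZ c x : f (c *: x) = c *: f x.
Proof. by rewrite -[c *: x]addr0 Hf islin0 addr0. Qed.

Lemma islinD x y : f (x + y) = f x + f y.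
Proof. by rewrite -[x in LHS]scale1r Hf scale1r. Qed.

Lemma islinN x : f (- x) = - f x.
Proof. by rewrite -scaleN1r islinZ scaleN1r. Qed.

Lemma islinB x y : f (x - y) = f x - f y.
Proof. by rewrite islinD islinN. Qed.

Lemma islin_sum (I : Type) (s : seq I) (P : pred I) (F : I -> V) :
  f (\sum_(i <- s | P i) F i) = \sum_(i <- s | P i) f (F i).
Proof. by elim/big_rec2: _ => [|i _ y _ <-]; [exact: islin0|exact: islinD]. Qed.

End Linear.

Lemma islin_comp (K : fieldType) (U V W : lmodType K) (f : V -> W) (g : U -> V) :
  islin K f -> islin K g -> islin K (f \o g).
Proof. by move=> Hf Hg c x y /=; rewrite Hg Hf. Qed.

(** * Words and walks *)

Section Words.
Variable A : finType.

(** All words are listed, composable or not: those with non-composable arrows act by zero on a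
    module, and the full list splits freely under concatenation. *)
Fixpoint words (k : nat) : seq (seq A) :=
  if k is k'.+1 then [seq a :: w | a <- enum A, w <- words k'] else [:: [::]].

Lemma big_words_succ (W : zmodType) k (F : seq A -> W) :
  \sum_(u <- words k.+1) F u = \sum_a \sum_(w <- words k) F (a :: w).
Proof. by rewrite big_allpairs_dep big_enum. Qed.

Lemma mem_words k u : (u \in words k) = (size u == k).
Proof.
elim: k u => [|k IH] [|a u] //=; first by apply/allpairsP=> -[[? ?] []].
rewrite eqSS -IH; apply/allpairsP/idP => [[[b w] /= [_ wk [_ ->]]] //|uk].
by exists (a, u); rewrite mem_enum.
Qed.

Lemma uniq_words k : uniq (words k).
Proof.
elim: k => //= k IH; apply: allpairs_uniq => //; first exact: enum_uniq.
by move=> [a w] [b v] _ _ /= [-> ->].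
Qed.

Lemma big_words_add (W : zmodType) k l (F : seq A -> W) :
  \sum_(u <- words (k + l)) F u = \sum_(v <- words k) \sum_(w <- words l) F (v ++ w).
Proof.
elim: k F => [|k IH] F; first by rewrite big_seq1.
by rewrite addSn !big_words_succ; apply: eq_bigr => a _; rewrite IH.
Qed.

Lemma big_allwords_succ (W : zmodType) k (F : seq A -> W) :
  \sum_(u <- allwords A k.+1) F u
    = F [::] + \sum_a \sum_(w <- allwords A k) F (a :: w).
Proof. by rewrite big_cons big_allpairs_dep big_enum. Qed.

Lemma mem_allwords k u : (u \in allwords A k) = (size u <= k)%N.
Proof.
elim: k u => [|k IH] [|a u] //=; rewrite inE /= ltnS -IH.
apply/allpairsP/idP => [[[b w] /= [_ wk [_ ->]]] //|uk].
by exists (a, u); rewrite mem_enum.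
Qed.

Lemma uniq_allwords k : uniq (allwords A k).
Proof.
elim: k => //= k IH; apply/andP; split; first by apply/allpairsP=> -[[? ?] []].
by apply: allpairs_uniq => [|//|[a w] [b v] _ _ /= [-> ->] //]; exact: enum_uniq.
Qed.

Lemma big_allwords_extend (W : zmodType) k (F : seq A -> W) :
  (forall u, (k < size u)%N -> F u = 0) ->
  \sum_(u <- allwords A k.+1) F u = \sum_(u <- allwords A k) F u.
Proof.
elim: k F => [|k IH] F F0; rewrite big_allwords_succ.
  rewrite big_seq1 big1 ?addr0 // => a _; rewrite big_seq1; exact: F0.
rewrite [RHS]big_allwords_succ; congr (_ + _); apply: eq_bigr => a _.
by apply: IH => u ku; apply: F0.
Qed.

End Words.

Section Walks.
Variables (n : nat) (A : finType) (src tgt : A -> 'I_n).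
Notation walkb := (walkb n A src tgt).
Notation endv := (endv n A tgt).
Notation precyclic := (precyclic n A src tgt).
Notation precycb := (precycb n A src tgt).

Lemma walkb_cons i a w : walkb i (a :: w) = (src a == i) && walkb (tgt a) w.
Proof.
by rewrite /walkb /=; case: w => //= b w; rewrite [tgt a == _]eq_sym.
Qed.

Lemma endv_cons i a w : endv i (a :: w) = endv (tgt a) w.
Proof. by []. Qed.

Lemma walkb_cat i u v : walkb i (u ++ v) = walkb i u && walkb (endv i u) v.
Proof.
elim: u i => [|a u IH] i //.
by rewrite cat_cons !walkb_cons IH endv_cons andbA.
Qed.

Lemma endv_cat i u v : endv i (u ++ v) = endv (endv i u) v.
Proof. by elim: u i => [|a u IH] i //; rewrite cat_cons !endv_cons IH. Qed.

Lemma precycbP i : reflect (precyclic i) (precycb i).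
Proof.
rewrite /Defs.precycb.
by case: ClassicalEpsilon.excluded_middle_informative => ?; constructor.
Qed.

Lemma precyclic_walk i w : walkb i w -> precyclic (endv i w) -> precyclic i.
Proof.
move=> iw [v [j [[wv ev] cj]]]; exists (w ++ v), j; split=> //; split.
  by rewrite walkb_cat iw.
by rewrite endv_cat.
Qed.

Lemma precyclic_arrow i : precyclic i -> exists2 a, src a = i & precyclic (tgt a).
Proof.
case=> w [j [[iw ej] cj]]; case: w => [|a w] in iw ej.
  (* The path to the cycle is empty, so [i] itself lies on the cycle: its first arrow serves, and
     the rest of the cycle leads back. *)
  case: cj ej => -[|a w] [// _ [jw je]] ji; rewrite /= in ji.
  move: jw; rewrite walkb_cons => /andP[/eqP sa aw].
  exists a; first by rewrite sa -ji.
  exists w, j; split; first by split.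
  by exists (a :: w); split=> //; split=> //; rewrite walkb_cons sa eqxx.
move: iw; rewrite walkb_cons => /andP[/eqP sa aw].
by exists a => //; exists w, j.
Qed.

Lemma precyclic_extend i k : precyclic i ->
  exists w, [/\ size w = k, walkb i w & precyclic (endv i w)].
Proof.
elim: k i => [|k IH] i pi; first by exists [::].
have [a <- /IH[w [<- aw pw]]] := precyclic_arrow pi.
by exists (a :: w); rewrite walkb_cons eqxx.
Qed.

End Walks.

(** * Modules over the truncated path algebra *)

Section Modules.
Variables (K : fieldType) (n : nat) (A : finType) (src tgt : A -> 'I_n) (L : nat).
Notation walkb := (walkb n A src tgt).
Notation endv := (endv n A tgt).
Notation precyclic := (precyclic n A src tgt).
Notation modData := (modData K n A).
Notation is_mod := (is_mod K n A src tgt L).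
Notation is_hom := (is_hom K n A).
Notation submod := (submod K n A).
Notation idem := (idem K n A _).
Notation arr := (arr K n A _).
Notation pathact := (pathact K n A _).
Notation radJ := (radJ K n A _).
Notation epsJ := (epsJ K n A src tgt _).

Lemma submod_subspace (M : modData) (U : M -> Prop) : submod U -> subspace U.
Proof. by case. Qed.

Lemma hom_comp (M N P : modData) (f : N -> P) (g : M -> N) :
  is_hom f -> is_hom g -> is_hom (f \o g).
Proof.
case=> fl fe fa [gl ge ga]; split; first exact: islin_comp.
  by move=> i x /=; rewrite ge fe.
by move=> a x /=; rewrite ga fa.
Qed.

Lemma hom_path (M N : modData) (f : M -> N) w x :
  is_hom f -> f (pathact w x) = pathact w (f x).
Proof. by case=> _ _ fa; elim: w x => //= a w IH x; rewrite IH fa. Qed.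

Lemma hom_radJ (M N : modData) (f : M -> N) x : is_hom f -> radJ x -> radJ (f x).
Proof.
move=> hf [s [s0 ->]]; have [fl _ _] := hf.
exists [seq (t.1, f t.2) | t <- s]; split; first by move=> _ /mapP[t ts ->]; exact: s0.
rewrite (islin_sum fl) big_map; apply: eq_bigr => t _.
by rewrite (islinZ fl) hom_path.
Qed.


Lemma path_cat (M : modData) u v (x : M) : pathact (u ++ v) x = pathact v (pathact u x).
Proof. exact: foldl_cat. Qed.

Lemma is_mod_surj (M N : modData) (f : M -> N) :
  is_mod M -> is_hom f -> Defs.surj f -> is_mod N.
Proof.
case=> el al es ee [ae ea an] hf sf; have [fl fe fa] := hf.
split; [| |move=> y|move=> i j y|split=> [a y|a y|w y sw]].
- move=> i c y z; have [x <-] := sf y; have [t <-] := sf z.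
  by rewrite -fl -!fe el fl.
- move=> a c y z; have [x <-] := sf y; have [t <-] := sf z.
  by rewrite -fl -!fa al fl.
- have [x <-] := sf y; rewrite -[in RHS](es x) (islin_sum fl).
  by apply: eq_bigr => i _; rewrite fe.
- by have [x <-] := sf y; rewrite -!fe ee; case: ifP => // _; exact: islin0.
- by have [x <-] := sf y; rewrite -fe -!fa ae.
- by have [x <-] := sf y; rewrite -fa -fe ea.
- by have [x <-] := sf y; rewrite -(hom_path _ _ hf) an // (islin0 fl).
Qed.

Lemma is_mod_inj (M N : modData) (f : M -> N) :
  is_mod N -> is_hom f -> injective f -> is_mod M.
Proof.
case=> el al es ee [ae ea an] hf inj; have [fl fe fa] := hf.
split; [| |move=> y|move=> i j y|split=> [a y|a y|w y sw]]; last 5 first.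
- by apply: inj; rewrite (islin_sum fl) -[RHS]es; apply: eq_bigr => i _; rewrite fe.
- by apply: inj; rewrite !fe ee -fe; case: ifP => // _; rewrite (islin0 fl).
- by apply: inj; rewrite !fa fe ae.
- by apply: inj; rewrite fe !fa ea.
- by apply: inj; rewrite hom_path // an // (islin0 fl).
- by move=> i c x y; apply: inj; rewrite fl !fe fl el.
- by move=> i c x y; apply: inj; rewrite fl !fa fl al.
Qed.

Lemma exists_submodule (M : modData) (U : M -> Prop) : is_mod M -> submod U ->
  exists (Z : modData) (g : Z -> M),
    [/\ is_mod Z, is_hom g, injective g & forall x, U x <-> exists z, g z = x].
Proof.
move=> hM HU; have [U0 Ul Ue Ua] := HU; have HS := submod_subspace HU.
pose S := subspace_type HS.
have US (z : S) : U (val z) by apply/asboolP; exact: (valP z).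
have eP i (z : S) : subspace_pred U (idem i (val z)) by apply/asboolP/Ue.
have aP a (z : S) : subspace_pred U (arr a (val z)) by apply/asboolP/Ua.
pose Z := @ModData K n A S (fun i z => Sub (idem i (val z)) (eP i z))
  (fun a z => Sub (arr a (val z)) (aP a z)).
pose g : Z -> M := fun z => val (z : S).
have hg : is_hom g.
  split=> [c x y|i x|a x]; rewrite /g ?SubK //=.
have gi : injective g by exact: val_inj.
exists Z, g; split=> //; first exact: is_mod_inj hM hg gi.
move=> x; split=> [Ux|[z <-]]; last exact: US.
have xP : subspace_pred U x by apply/asboolP.
by exists (Sub x xP : S); rewrite /g SubK.
Qed.

(** The quotient is realized on a linear complement of [U], the image of a projection with kernel
    [U]; each generator acts and the result is projected back. *)
Lemma exists_quotient (M : modData) (U : M -> Prop) : is_mod M -> submod U ->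
  exists (X : modData) (f : M -> X),
    [/\ is_mod X, is_hom f, Defs.surj f & forall x, f x = 0 <-> U x].
Proof.
move=> hM HU; have [U0 Ul Ue Ua] := HU; have HS := submod_subspace HU.
have [el al _ _ _] := hM.
have [p [pl p0 pU]] := exists_projection HS.
have HT : subspace (fun x => exists y, x = p y).
  split=> [|c _ _ [x ->] [y ->]]; first by exists 0; rewrite (islin0 pl).
  by exists (c *: x + y); rewrite pl.
pose S := subspace_type HT.
have pP x : subspace_pred (fun x => exists y, x = p y) (p x) by apply/asboolP; exists x.
pose q x : S := Sub (p x) (pP x).
have qK x : val (q x) = p x by exact: SubK.
have qE x y : U (x - y) -> q x = q y.
  move=> Uxy; apply: val_inj; rewrite !qK; apply/eqP.
  by rewrite -subr_eq0 -(islinB pl); apply/eqP/p0.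
have ql c x y : q (c *: x + y) = c *: q x + q y.
  by apply: val_inj; rewrite linearP !qK pl.
have qs z : exists x, q x = z.
  have /asboolP[x zx] := valP z; exists x; apply: val_inj; by rewrite qK -zx.
pose X := @ModData K n A S (fun i z => q (idem i (val z))) (fun a z => q (arr a (val z))).
have qhom : @Defs.is_hom K n A M X q.
  split=> [|i x|a x]; first exact: ql.
    apply: etrans (congr1 (q \o idem i) (esym (qK x))); apply: qE.
    by rewrite -(islinB (el i)); apply: Ue.
  apply: etrans (congr1 (q \o arr a) (esym (qK x))); apply: qE.
  by rewrite -(islinB (al a)); apply: Ua.
exists X, q; split=> //; first exact: is_mod_surj hM qhom qs.
move=> x; split=> [qx0|Ux].
  by apply/p0; have := congr1 val qx0; rewrite qK raddf0.
by rewrite -[RHS](islin0 ql); apply: qE; rewrite subr0.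
Qed.

Section Module.
Variables (M : modData) (hM : is_mod M).
Implicit Types x y : M.

Lemma idem_lin i : islin K (idem i : M -> M). Proof. by case: hM => el. Qed.
Lemma arr_lin a : islin K (arr a : M -> M). Proof. by case: hM. Qed.

Lemma path_lin w : islin K (pathact w : M -> M).
Proof. by elim: w => //= a w IH c x y /=; rewrite arr_lin IH. Qed.

Lemma sum_idem x : \sum_i idem i x = x. Proof. by case: hM. Qed.

Lemma idem_idem i j x : idem i (idem j x) = if i == j then idem j x else 0.
Proof. by case: hM. Qed.

Lemma idem_id i x : idem i (idem i x) = idem i x.
Proof. by rewrite idem_idem eqxx. Qed.

Lemma arr_idem a i x : arr a (idem i x) = if src a == i then arr a x else 0.
Proof.
case: hM => _ _ _ ee [ae _ _]; rewrite -ae ee; case: eqP => [<-|_]; first exact: ae.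
exact: islin0 (arr_lin a).
Qed.

Lemma idem_arr i a x : idem i (arr a x) = if i == tgt a then arr a x else 0.
Proof. by case: hM => _ _ _ ee [_ ea _]; rewrite -ea ee. Qed.

Lemma path_long w x : (L < size w)%N -> pathact w x = 0.
Proof.
case: hM => _ _ _ _ [_ _ an] Lw; rewrite -(cat_take_drop L.+1 w) path_cat.
by rewrite (an (take _ _)) ?size_takel // (islin0 (path_lin _)).
Qed.

Lemma path_idem i j w x : idem j (pathact w (idem i x))
  = if walkb i w && (endv i w == j) then pathact w (idem i x) else 0.
Proof.
elim: w i x => [|a w IH] i x; first by rewrite /= idem_idem eq_sym; case: eqP => // <-.
rewrite walkb_cons endv_cons [pathact _ _]/=; rewrite arr_idem.
case: eqP => _ /=; last by rewrite !(islin0 (path_lin _)) (islin0 (idem_lin _)).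
have -> : arr a x = idem (tgt a) (arr a x) by rewrite idem_arr eqxx.
exact: IH.
Qed.

Lemma idem_path j w x :
  idem j (pathact w x) = pathact w (\sum_(i | walkb i w && (endv i w == j)) idem i x).
Proof.
rewrite -{1}(sum_idem x) !(islin_sum (path_lin w)) (islin_sum (idem_lin j)).
by rewrite [RHS]big_mkcond /=; apply: eq_bigr => i _; exact: path_idem.
Qed.

Lemma radJP x : radJ x <-> exists y : A -> M, x = \sum_a arr a (y a).
Proof.
split=> [[s [s0 ->]]|[y ->]].
  have HS : subspace (fun x => exists y : A -> M, x = \sum_a arr a (y a)).
    split; first by exists (fun=> 0); rewrite big1 // => a _; exact: islin0 (arr_lin a).
    move=> c _ _ [y ->] [z ->]; exists (fun a => c *: y a + z a).
    by rewrite scaler_sumr -big_split; apply: eq_bigr => a _; rewrite arr_lin.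
  apply: (subspace_sum_seq HS) => t ts; apply: (subspace_scale HS).
  move: (s0 t ts); case/lastP: (t.1.1) => [//|w a _].
  exists (fun b => if b == a then pathact w t.2 else 0).
  rewrite (bigD1 a) //= eqxx big1 ?addr0 => [|b ba]; first by rewrite -cats1 path_cat.
  by rewrite (negPf ba) (islin0 (arr_lin b)).
exists [seq ([:: a], 1, y a) | a <- enum A]; split; first by move=> _ /mapP[a _ ->].
by rewrite big_map big_enum; apply: eq_bigr => a _ /=; rewrite scale1r.
Qed.

Lemma radJ_arr a x : radJ (arr a x).
Proof.
exists [:: ([:: a], 1, x)]; split=> [t|]; rewrite ?inE ?big_seq1 ?scale1r //.
by move=> /eqP ->.
Qed.

Lemma submod_radJ : submod (radJ : M -> Prop).
Proof.
split.
- by exists [::]; rewrite big_nil.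
- move=> c x y /radJP[u ->] /radJP[v ->]; apply/radJP.
  exists (fun a => c *: u a + v a).
  by rewrite scaler_sumr -big_split; apply: eq_bigr => a _; rewrite arr_lin.
- move=> i x /radJP[u ->]; apply/radJP; exists (fun a => if i == tgt a then u a else 0).
  rewrite (islin_sum (idem_lin i)); apply: eq_bigr => a _; rewrite idem_arr.
  by case: eqP => // _; rewrite (islin0 (arr_lin a)).
- by move=> a x _; exact: radJ_arr.
Qed.

Lemma submod_path (U : M -> Prop) w x : submod U -> U x -> U (pathact w x).
Proof. by case=> _ _ _ Ua; elim: w x => //= a w IH x Ux; apply/IH/Ua. Qed.

Lemma radJ_path w x : w <> [::] -> radJ (pathact w x).
Proof. by case/lastP: w => // w a _; rewrite -cats1 path_cat; exact: radJ_arr. Qed.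

Lemma path_radJ_long w x : radJ x -> (L <= size w)%N -> pathact w x = 0.
Proof.
move=> /radJP[y ->] Lw; rewrite (islin_sum (path_lin w)) big1 // => a _.
exact: (@path_long (a :: w) (y a)).
Qed.

(** J is nilpotent, so no finite generation is required: J^k M lies in [U] for k = L+1, where it is
    zero, and then for each smaller k, down to the empty word. *)
Lemma nakayama (U : M -> Prop) : submod U ->
  (forall x, exists2 u, U u & radJ (x - u)) -> forall x, U x.
Proof.
move=> HU gen x; have HS := submod_subspace HU.
suff H d w y : (size w + d)%N = L.+1 -> U (pathact w y) by exact: (H L.+1 [::]).
elim: d w y => [|d IH] w y; first by rewrite addn0 => sw; rewrite path_long ?sw //; case: HU.
rewrite addnS -addSn => sw; have [u Uu /radJP[z zE]] := gen y.
rewrite -[y](subrK u) zE (islinD (path_lin w)) (islin_sum (path_lin w)).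
apply: (subspace_add HS); last exact: submod_path.
by apply: (subspace_sum HS) => a _; exact: (IH (a :: w)).
Qed.

Lemma idem_epsact j x : precyclic j -> idem j (epsact K n A src tgt M x) = 0.
Proof.
move=> /precycbP pj; rewrite (islin_sum (idem_lin j)) big1 // => i ni.
by rewrite idem_idem; case: eqP ni => // <-; rewrite pj.
Qed.

(** Elements vanishing at all precyclic vertices are fixed by epsilon, whence epsilon J M is the
    intersection of JM and epsilon M. *)
Lemma epsJP x : epsJ x <-> radJ x /\ forall j, precyclic j -> idem j x = 0.
Proof.
have [_ _ Je _] := submod_radJ; split=> [[y [Jy ->]]|[Jx x0]].
  split; last by move=> j pj; exact: idem_epsact.
  by apply: (subspace_sum (submod_subspace submod_radJ)) => i _; exact: Je.
exists x; split=> //; rewrite -[LHS]sum_idem (bigID (precycb n A src tgt)) /=.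
by rewrite big1 ?add0r // => i /precycbP; exact: x0.
Qed.

(** This is epsilon M. An arrow into a precyclic vertex starts at a precyclic vertex, so it kills
    these elements. *)
Lemma submod_nonprecyclic : submod (fun x : M => forall j, precyclic j -> idem j x = 0).
Proof.
split.
- by move=> j _; exact: islin0 (idem_lin j).
- by move=> c x y Hx Hy j pj; rewrite idem_lin Hx // Hy // scaler0 addr0.
- move=> i x Hx j pj; rewrite idem_idem; case: eqP => // <-; exact: Hx.
- move=> a x Hx j pj; rewrite idem_arr; case: eqP => // ja.
  have := arr_idem a (src a) x; rewrite eqxx => <-; rewrite Hx ?(islin0 (arr_lin a)) //.
  by apply: (@precyclic_walk _ _ src tgt _ [:: a]); [rewrite walkb_cons eqxx|rewrite ja in pj].
Qed.

Lemma submod_epsJ : submod (epsJ : M -> Prop).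
Proof.
have [J0 Jl Je Ja] := submod_radJ; have [N0 Nl Ne Na] := submod_nonprecyclic.
split=> [|c x y /epsJP[? ?] /epsJP[? ?]|i x /epsJP[? ?]|a x /epsJP[? ?]];
  by apply/epsJP; split; auto.
Qed.

End Module.

Lemma hom_epsJ (M N : modData) (f : M -> N) x :
  is_mod M -> is_mod N -> is_hom f -> epsJ x -> epsJ (f x).
Proof.
move=> hM hN hf /(epsJP hM)[Jx x0]; apply/(epsJP hN); split; first exact: hom_radJ.
by case: hf => fl fe _ j pj; rewrite -fe x0 // (islin0 fl).
Qed.

Lemma submod_hom_kernel (M N : modData) (f : M -> N) :
  is_mod N -> is_hom f -> submod (fun x => f x = 0).
Proof.
move=> hN [fl fe fa]; split; first exact: islin0.
- by move=> c x y fx fy; rewrite fl fx fy scaler0 addr0.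
- by move=> i x fx; rewrite fe fx (islin0 (idem_lin hN i)).
- by move=> a x fx; rewrite fa fx (islin0 (arr_lin hN a)).
Qed.

Lemma submod_hom_image (M N : modData) (f : M -> N) :
  is_hom f -> submod (fun y => exists x, f x = y).
Proof.
case=> fl fe fa; split; first by exists 0; exact: islin0.
- by move=> c _ _ [x <-] [y <-]; exists (c *: x + y).
- by move=> i _ [x <-]; exists (idem i x).
- by move=> a _ [x <-]; exists (arr a x).
Qed.

(** * Good modules and exact sequences *)

Lemma big_path_split (M : modData) (hM : is_mod M) l k (p : seq A -> M) : (l <= k)%N ->
  exists q : seq A -> M,
    \sum_(u <- words A k) pathact u (p u) = \sum_(v <- words A l) pathact v (q v) /\
    ((l < k)%N -> forall v, radJ (q v)).
Proof.
move=> lk; exists (fun v => \sum_(w <- words A (k - l)) pathact w (p (w ++ v))); split.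
  rewrite -{1}(subnK lk) big_words_add exchange_big /=; apply: eq_bigr => v _.
  by rewrite (islin_sum (path_lin hM v)); apply: eq_bigr => w _; rewrite path_cat.
rewrite -subn_gt0 => kl v.
apply: (subspace_sum_seq (submod_subspace (submod_radJ hM))) => w.
by rewrite mem_words => /eqP sw; apply: radJ_path => // w0; rewrite -sw w0 in kl.
Qed.

(** Coefficients in JM let each word grow by one arrow. Only walks ending at [j] contribute to the
    component there, so the hypothesis concerns these alone. This is the induction step of
    [good_extension] and of [good_kernel]. *)
Lemma idem_path_radJ (M : modData) (hM : is_mod M) k j (p : seq A -> M) :
  (forall i v, size v = k -> walkb i v -> endv i v = j -> radJ (idem i (p v))) ->
  exists q : seq A -> M, idem j (\sum_(v <- words A k) pathact v (p v))
    = \sum_(u <- words A k.+1) pathact u (q u).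
Proof.
move=> H; pose r v : M := \sum_(i | walkb i v && (endv i v == j)) idem i (p v).
have Jr v : exists y : A -> M, size v = k -> r v = \sum_a arr a (y a).
  have [sv|sv] := eqVneq (size v) k; last by exists (fun=> 0) => e; rewrite e eqxx in sv.
  have /(radJP hM)[y yE] : radJ (r v).
    apply: (subspace_sum (submod_subspace (submod_radJ hM))) => i /andP[iv /eqP ej].
    exact: H.
  by exists y.
have [y yP] := choice Jr; exists (fun u => if u is a :: v then y v a else 0).
rewrite big_words_succ exchange_big (islin_sum (idem_lin hM j)) /=.
apply: eq_big_seq => v; rewrite mem_words => /eqP sv.
rewrite (idem_path hM) -/(r v) yP // (islin_sum (path_lin hM v)).
exact: eq_bigr.
Qed.

(* Over the algebra of the precyclic vertices, [good M] expresses that M is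
   projective: J^L (x) M/JM embeds into M, and similarly for J^k with k <= L. *)
Definition good (M : modData) : Prop :=
  forall k j (m : seq A -> M), (k <= L)%N -> precyclic j ->
    idem j (\sum_(u <- words A k) pathact u (m u)) = 0 ->
    forall i u, size u = k -> walkb i u -> endv i u = j -> radJ (idem i (m u)).

(** J^L detects the top of a good module at precyclic vertices: goodness is applied to a family
    supported at one path [w] of length L that ends at a precyclic vertex. *)
Lemma good_detect (M : modData) (hM : is_mod M) i x : good M -> precyclic i ->
  (forall w, size w = L -> pathact w (idem i x) = 0) -> radJ (idem i (idem i x : M)).
Proof.
move=> gM pi x0; have [w [sw iw pw]] := precyclic_extend L pi.
have := gM L _ (fun u => if u == w then idem i x else 0) (leqnn L) pw _ i w sw iw erefl.
rewrite eqxx; apply; rewrite big1 ?(islin0 (idem_lin hM _)) // => u _.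
by case: eqP => [->|_]; [exact: x0|exact: islin0 (path_lin hM u)].
Qed.

Lemma good_summand (P C : modData) (f : C -> P) (g : P -> C) :
  is_hom f -> is_hom g -> cancel g f -> good C -> good P.
Proof.
move=> hf hg gK gC k j m kL pj m0 i u su iu ej; have [fl fe fa] := hf.
have [gl ge ga] := hg; rewrite -[m u]gK -fe; apply: hom_radJ => //.
apply: (gC k j (g \o m)) => //=.
rewrite -[RHS](islin0 gl) -m0 ge (islin_sum gl); congr (idem j _).
by apply: eq_bigr => v _; rewrite (hom_path _ _ hg).
Qed.

(* J^L annihilates JP, so good_detect shows that an element of gZ at a precyclic
   vertex that lies in JP already lies in g(JZ); inductively, J^k P meets gZ in
   g(J^k Z) at precyclic vertices for k <= L. *)
Lemma good_extension (M P Z : modData) (f : P -> M) (g : Z -> P) :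
  is_mod M -> is_mod P -> is_mod Z ->
  is_hom f -> Defs.surj f -> is_hom g -> injective g ->
  (forall x, f x = 0 <-> exists z, g z = x) -> good P -> good Z -> good M.
Proof.
move=> hM hP hZ hf fs hg gi exa gP gZ k j m kL pj m0 i u su iu ej.
have [fl fe fa] := hf; have [gl ge ga] := hg; have HJ := submod_subspace (submod_radJ hP).
have [s sK] := choice fs; pose p := s \o m.
pose x := idem j (\sum_(v <- words A k) pathact v (p v)).
have jx : idem j x = x by exact: (idem_id hP).
have [t xt] : exists t, g t = x.
  apply/exa; rewrite fe (islin_sum fl) -[RHS]m0; congr (idem j _).
  by apply: eq_bigr => v _; rewrite (hom_path _ _ hf) /p /= sK.
have radJ_g l (z : Z) : precyclic l -> radJ (g (idem l z)) -> radJ (idem l z).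
  move=> pl Jz; rewrite -(idem_id hZ); apply: good_detect => // w sw.
  by apply: gi; rewrite (hom_path _ _ hg) (path_radJ_long hP Jz) ?sw // (islin0 gl).
have H l : (l <= k)%N -> exists z : seq A -> Z,
    x = g (idem j (\sum_(v <- words A l) pathact v (z v))).
  elim: l => [_|l IH lk]; first by exists (fun=> t); rewrite big_seq1 ge xt.
  have [z xz] := IH (ltnW lk).
  (* Two expressions of [x] by words of length [l] are compared: at the starting vertex goodness of
     P puts [g (z v) - q v] into JP, and [q v] is there already because [l < k]. Then [radJ_g]
     brings [z v] into JZ. *)
  have [q [qE /(_ lk) Jq]] := big_path_split hP p (ltnW lk).
  have [r rE] : exists r : seq A -> Z, idem j (\sum_(v <- words A l) pathact v (z v))
      = \sum_(v <- words A l.+1) pathact v (r v).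
    apply: idem_path_radJ => // i' v sv iv ev; apply: radJ_g => //.
      by apply: precyclic_walk iv _; rewrite ev.
    rewrite (ge i' (z v)) -[g (z v)](subrK (q v)) (islinD (idem_lin hP i')).
    apply: (subspace_add HJ); last by have [_ _ Je _] := submod_radJ hP; exact: (Je i' _ (Jq v)).
    apply: (gP l j (fun v => g (z v) - q v) _ pj _ i' v sv iv ev).
      exact: leq_trans (ltnW lk) kL.
    under eq_bigr => w _ do rewrite (islinB (path_lin hP w)).
    rewrite sumrB -qE (islinB (idem_lin hP j)) -/x xz ge (islin_sum gl).
    under [X in _ - idem j X]eq_bigr => w _ do rewrite (hom_path _ _ hg).
    exact: subrr.
  by exists r; rewrite -rE ge -xz jx.
have [z xz] := H k (leqnn k).
(* At length [k] the lift [p u] agrees at [i] with [g (z u)] up to JP, and [f] kills the latter. *)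
have : radJ (idem i (p u - g (z u))).
  apply: (gP k j (fun v => p v - g (z v))) => //.
  under eq_bigr => w _ do rewrite (islinB (path_lin hP w)).
  rewrite sumrB (islinB (idem_lin hP j)) -/x xz ge (islin_sum gl).
  under [X in _ - idem j X]eq_bigr => w _ do rewrite -(hom_path _ _ hg).
  exact: subrr.
move/(hom_radJ hf); rewrite fe (islinB fl) /p /= sK.
by have -> : f (g (z u)) = 0; [apply/exa; exists (z u)|rewrite subr0].
Qed.

Lemma radJ_lift (P M : modData) (f : P -> M) x : is_mod P -> is_mod M -> is_hom f ->
  Defs.surj f -> (forall y, f y = 0 -> radJ y) -> radJ (f x) -> radJ x.
Proof.
move=> hP hM hf fs fJ /(radJP hM)[y yE]; have [fl fe fa] := hf.
have [s sK] := choice fs.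
have Jy : radJ (\sum_a arr a (s (y a))) by apply/(radJP hP); exists (s \o y).
rewrite -[x](subrK (\sum_a arr a (s (y a)))).
apply: (subspace_add (submod_subspace (submod_radJ hP))) => //.
apply: fJ; rewrite (islinB fl) yE (islin_sum fl) [X in _ - X](eq_bigr (fun a => arr a (y a))).
  exact: subrr.
by move=> a _; rewrite fa sK.
Qed.

(* The component of x at a precyclic vertex lies in J^k P for every k. *)
Lemma good_kernel (P M : modData) (f : P -> M) : is_mod P -> is_mod M -> is_hom f ->
  Defs.surj f -> (forall y, f y = 0 -> radJ y) -> good M ->
  forall x j, f x = 0 -> precyclic j -> idem j x = 0.
Proof.
move=> hP hM hf fs fJ gM x j fx pj; have [fl fe fa] := hf.
(* The induction reaches L+1 because it uses goodness only at lengths at most L; words of length L+1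
   act by zero. *)
have H k : (k <= L.+1)%N -> exists p : seq A -> P,
    idem j x = \sum_(v <- words A k) pathact v (p v).
  elim: k => [_|k IH kL]; first by exists (fun=> idem j x); rewrite big_seq1.
  have [p pE] := IH (ltnW kL); rewrite -(idem_id hP j x) pE.
  apply: idem_path_radJ => // i v sv iv ev.
  apply: (radJ_lift hP hM hf) => //; rewrite fe.
  apply: (gM k j (f \o p)) => //=.
  apply: etrans (_ : f (idem j (idem j x)) = 0); last first.
    by rewrite (idem_id hP) fe fx; exact: islin0 (idem_lin hM j).
  rewrite pE fe (islin_sum fl); congr (idem j _).
  by apply: eq_bigr => w _; rewrite (hom_path _ _ hf).
have [p ->] := H _ (leqnn _); rewrite big1_seq // => v /andP[_].
by rewrite mem_words => /eqP sv; rewrite (path_long hP) ?sv.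
Qed.

Lemma proj_cover_radJ (P M : modData) (f : P -> M) x :
  is_mod M -> proj_cover K n A src tgt L f -> f x = 0 -> radJ x.
Proof.
move=> hM [hP _ hf fs sup] fx; have [fl fe fa] := hf.
have HJ := submod_radJ hP; have [J0 Jl Je Ja] := HJ.
rewrite -(sum_idem hP x); apply: (subspace_sum (submod_subspace HJ)) => i _.
apply: contrapT => nJ; pose U (y : P) := radJ (idem i y).
have HU : subspace U.
  split=> [|c y z]; rewrite /U; first by rewrite (islin0 (idem_lin hP i)).
  by rewrite (idem_lin hP); exact: Jl.
have [h [hl hU hx]] := exists_functional HU (nJ : ~ U x).
have hB y z : h (y - z) = h y - h z by rewrite addrC -scaleN1r hl mulN1r addrC.
have h00 : h 0 = 0 by exact: hU HU.1.
suff h0 y : h y = 0 by move/eqP: hx; rewrite h0 eq_sym oner_eq0.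
apply: (sup (fun y => h y = 0)) => [|z].
  split; first exact: h00.
  - by move=> c u v hu hv; rewrite hl hu hv mulr0 addr0.
  - move=> l u hu; have [<-|il] := eqVneq i l; last first.
      by apply: hU; rewrite /U (idem_idem hP) (negPf il); exact: J0.
    suff: h (u - idem i u) = 0 by rewrite hB hu sub0r => /eqP; rewrite oppr_eq0 => /eqP.
    by apply: hU; rewrite /U (islinB (idem_lin hP i)) (idem_id hP) subrr; exact: J0.
  - by move=> a u _; apply/hU/Je/radJ_arr.
exists (z - h z *: x), (h z *: x); split; last split.
- by rewrite hB -[h z *: x]addr0 hl hx h00 addr0 mulr1 subrr.
- by rewrite (islinZ fl) fx scaler0.
- by rewrite subrK.
Qed.

(** * Free modules *)

Lemma path_nonwalk (M : modData) (hM : is_mod M) i w (x : M) :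
  ~~ walkb i w -> pathact w (idem i x) = 0.
Proof.
move=> nw; rewrite -[LHS](sum_idem hM) big1 // => j _.
by rewrite (path_idem hM) (negPf nw).
Qed.

(* Words are reversed inside free modules (last arrow first), so that an arrow
   acts by consing. *)
Definition rev_end (i : 'I_n) (r : seq A) : 'I_n := if r is b :: _ then tgt b else i.

Definition rev_walk (i : 'I_n) (r : seq A) : bool := (size r <= L)%N && walkb i (rev r).

Lemma endv_rev i r : endv i (rev r) = rev_end i r.
Proof. by case: r => // a r; rewrite rev_cons -cats1 endv_cat. Qed.

Lemma rev_walk_cons i a r :
  rev_walk i (a :: r) = [&& (size r < L)%N, src a == rev_end i r & rev_walk i r].
Proof.
rewrite /rev_walk rev_cons -cats1 walkb_cat walkb_cons endv_rev andbT /=.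
by case: ltngtP => //=; rewrite andbC.
Qed.

Section Free.
Variables (V : lmodType K) (th : 'I_n -> V -> V).
Hypotheses (th_lin : forall i, islin K (th i)) (th_id : forall i x, th i (th i x) = th i x).

(** A pair [(i, r)] stands for the path from [i] with reversed word [r]. Only finitely many pairs
    are paths of length at most L, so functions with this support form the direct sum without a
    finiteness condition. *)
Definition free_coef (f : 'I_n * seq A -> V) : Prop :=
  forall i r, th i (f (i, r)) = f (i, r) /\ (~~ rev_walk i r -> f (i, r) = 0).

Lemma subspace_free_coef : subspace free_coef.
Proof.
split=> [i r|c f g Hf Hg i r]; first by split=> //; exact: islin0 (th_lin i).
have [fi fr] := Hf i r; have [gi gr] := Hg i r.
change ((c *: f + g) (i, r)) with (c *: f (i, r) + g (i, r)).
split; first by rewrite th_lin fi gi.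
by move=> nr; rewrite fr // gr // scaler0 addr0.
Qed.

Let free_type := subspace_type subspace_free_coef.

Definition free_idem_fun j (f : 'I_n * seq A -> V) : 'I_n * seq A -> V :=
  fun p => if rev_end p.1 p.2 == j then f p else 0.

(** Testing [rev_walk] on the longer word both rejects non-composable arrows and truncates at length
    L. *)
Definition free_arr_fun a (f : 'I_n * seq A -> V) : 'I_n * seq A -> V :=
  fun p => if p.2 is b :: r then
    if (b == a) && rev_walk p.1 (b :: r) then f (p.1, r) else 0 else 0.

Lemma free_idem_subproof j (x : free_type) :
  subspace_pred free_coef (free_idem_fun j (val x)).
Proof.
have /asboolP Hx := valP x; apply/asboolP => i r; rewrite /free_idem_fun /=.
by case: ifP => _; [exact: Hx|split=> //; exact: islin0 (th_lin i)].
Qed.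

Lemma free_arr_subproof a (x : free_type) :
  subspace_pred free_coef (free_arr_fun a (val x)).
Proof.
have /asboolP Hx := valP x; apply/asboolP => i [|b r]; rewrite /free_arr_fun /=.
  by split=> //; exact: islin0 (th_lin i).
case: ifP => [/andP[_ br]|_]; last by split=> //; exact: islin0 (th_lin i).
by split; [exact: (Hx i r).1|rewrite br].
Qed.

(* Lambda (x) V over the span of the vertices, where V = (+)_i th_i V *)
Definition free_mod : modData := @ModData K n A free_type
  (fun j x => Sub (free_idem_fun j (val x)) (free_idem_subproof j x))
  (fun a x => Sub (free_arr_fun a (val x)) (free_arr_subproof a x)).

Definition coef (x : free_mod) : 'I_n * seq A -> V := val (x : free_type).

Lemma coef_inj x y : (forall i r, coef x (i, r) = coef y (i, r)) -> x = y.
Proof. by move=> xy; apply: val_inj; apply: funext => -[i r]; exact: xy. Qed.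

Lemma exists_coef f : free_coef f -> exists x, coef x = f.
Proof. by move=> /asboolP Hf; exists (Sub f Hf : free_type); exact: SubK. Qed.

Lemma coef_th x i r : th i (coef x (i, r)) = coef x (i, r).
Proof. by have /asboolP Hx := valP (x : free_type); have [] := Hx i r. Qed.

Lemma coef_nonpath x i r : ~~ rev_walk i r -> coef x (i, r) = 0.
Proof. by have /asboolP Hx := valP (x : free_type); have [_] := Hx i r. Qed.

Lemma coef_lin p : islin K (fun x : free_mod => coef x p : V).
Proof. by []. Qed.

Lemma coef_idem j x i r : coef (idem j x) (i, r) = if rev_end i r == j then coef x (i, r) else 0.
Proof. by []. Qed.

Lemma coef_arr_nil a x i : coef (arr a x) (i, [::]) = 0.
Proof. by []. Qed.

Lemma coef_arr a x i b r : coef (arr a x) (i, b :: r) =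
  if (b == a) && rev_walk i (b :: r) then coef x (i, r) else 0.
Proof. by []. Qed.

Lemma coef_path w x i r : coef (pathact w x) (i, r) =
  if prefix (rev w) r && rev_walk i r then coef x (i, drop (size w) r) else 0.
Proof.
elim/last_ind: w r => [|w a IH] r.
  rewrite prefix0s drop0 /=; case: ifPn => //; exact: coef_nonpath.
rewrite -cats1 path_cat [pathact [:: a] _]/= cats1 rev_rcons.
case: r => [|b r]; first by rewrite coef_arr_nil.
rewrite coef_arr IH size_rcons /= [a == b]eq_sym; case: eqP => _ //=.
case: ifPn => [br|_]; last by rewrite andbF.
by rewrite andbT; move: br; rewrite rev_walk_cons => /and3P[_ _ ->]; rewrite andbT.
Qed.

Lemma is_mod_free : is_mod free_mod.
Proof.
have E (x y : free_mod) : (forall i r, coef x (i, r) = coef y (i, r)) -> x = y.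
  exact: coef_inj.
split=> [j|a|x|j l x|]; last split=> [a x|a x|w x sw].
- move=> c x y; apply: E => i r; rewrite coef_lin !coef_idem coef_lin.
  by case: ifP => //; rewrite scaler0 addr0.
- move=> c x y; apply: E => i [|b r].
    by rewrite coef_lin !coef_arr_nil scaler0 addr0.
  rewrite coef_lin !coef_arr coef_lin.
  by case: ifP => //; rewrite scaler0 addr0.
- apply: E => i r; rewrite (islin_sum (coef_lin (i, r))).
  rewrite (bigD1 (rev_end i r)) //= coef_idem eqxx big1 ?addr0 // => j.
  by rewrite coef_idem eq_sym => /negPf ->.
- apply: E => i r; case: (j =P l) => [->|jl]; rewrite !coef_idem; first by case: eqP.
  by case: eqP => // ->; case: eqP.
- apply: E => i [|b r]; first by rewrite !coef_arr_nil.
  rewrite !coef_arr coef_idem; case: ifP => // /andP[/eqP ->].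
  by rewrite rev_walk_cons => /and3P[_ /eqP <- _]; rewrite eqxx.
- apply: E => i [|b r]; first by rewrite coef_idem !coef_arr_nil if_same.
  rewrite coef_idem !coef_arr /=; case: (b =P a) => [->|_]; last by rewrite if_same.
  by rewrite eqxx.
- apply: E => i r; rewrite coef_path (islin0 (coef_lin (i, r))).
  case: ifP => // /andP[/size_prefix]; rewrite size_rev sw => Lr /andP[rL _].
  by have := leq_trans Lr rL; rewrite ltnn.
Qed.

Lemma exists_gen i t : exists x : free_mod, forall j r,
  coef x (j, r) = if (j == i) && (r == [::]) then th i t else 0.
Proof.
pose f (p : 'I_n * seq A) := if (p.1 == i) && (p.2 == [::]) then th i t else 0.
have [j r|x xf] := @exists_coef f; last by exists x => j r; rewrite xf.
rewrite /f /=; case: ifP => [/andP[/eqP -> /eqP ->]|_]; first by rewrite th_id.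
by split=> //; exact: islin0 (th_lin j).
Qed.

Definition free_gen i t : free_mod := projT1 (cid (exists_gen i t)).

Lemma coef_gen i t j r : coef (free_gen i t) (j, r) = if (j == i) && (r == [::]) then th i t else 0.
Proof. by rewrite /free_gen; case: cid. Qed.

Lemma gen_lin i : islin K (free_gen i).
Proof.
move=> c s t; apply: coef_inj => j r; rewrite coef_lin !coef_gen th_lin.
by case: ifP => //; rewrite scaler0 addr0.
Qed.

Lemma idem_gen i j t : idem j (free_gen i t) = if i == j then free_gen i t else 0.
Proof.
apply: coef_inj => l r; rewrite coef_idem coef_gen.
rewrite (fun_if (fun x => coef x (l, r))) coef_gen (islin0 (coef_lin _)).
by case: (l =P i) => [->|_]; case: r => [|b r]; rewrite /= ?if_same.
Qed.

Lemma coef_path_gen i t w j r : coef (pathact w (free_gen i t)) (j, r) =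
  if [&& j == i, r == rev w & rev_walk i r] then th i t else 0.
Proof.
rewrite coef_path coef_gen.
have -> : (r == rev w) = prefix (rev w) r && (drop (size w) r == [::]).
  rewrite -size_eq0 size_drop subn_eq0; apply/eqP/andP => [->|[/prefixP[s ->]]].
    by rewrite prefix_refl size_rev.
  by rewrite size_cat size_rev; case: s => [|b s]; rewrite ?cats0 // addnS ltnNge leq_addr.
case: (j =P i) => [->|_] /=; last by rewrite if_same.
by case: prefix => //=; case: rev_walk; rewrite ?andbF ?andbT.
Qed.

Lemma free_expand x :
  x = \sum_i \sum_(r <- allwords A L) pathact (rev r) (free_gen i (coef x (i, r))).
Proof.
apply: coef_inj => i r; rewrite (islin_sum (coef_lin (i, r))) (bigD1 i) //=.
rewrite [X in _ + X]big1 ?addr0 => [|j ji]; last first.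
  rewrite (islin_sum (coef_lin (i, r))) big1 // => s _.
  by rewrite coef_path_gen eq_sym (negPf ji).
rewrite (islin_sum (coef_lin (i, r))); have [ir|nir] := boolP (rev_walk i r); last first.
  rewrite coef_nonpath // big1 // => s _; rewrite coef_path_gen (negPf nir).
  by rewrite !andbF.
rewrite (bigD1_seq r) ?uniq_allwords ?mem_allwords /=; try by case/andP: ir.
rewrite coef_path_gen revK !eqxx ir coef_th big1 ?addr0 // => s sr.
by rewrite coef_path_gen revK [r == s]eq_sym (negPf sr) andbF.
Qed.

Lemma radJ_free x : radJ x <-> forall i, coef x (i, [::]) = 0.
Proof.
have hF := is_mod_free; have HJ := submod_subspace (submod_radJ hF).
split=> [/(radJP hF)[y ->] i|x0].
  by rewrite (islin_sum (coef_lin _)) big1.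
rewrite (free_expand x); apply: (subspace_sum HJ) => i _; apply: (subspace_sum HJ) => r _.
case: r => [|b r]; last by apply: radJ_path; rewrite rev_cons -cats1; case: (rev r).
by rewrite x0 (islin0 (gen_lin i)); exact: HJ.1.
Qed.

Lemma epsJ_free x : epsJ x <->
  forall i r, r = [::] \/ precyclic (rev_end i r) -> coef x (i, r) = 0.
Proof.
have hF := is_mod_free; split=> [/(epsJP hF)[/radJ_free Jx ex] i r [->|pj]|x0]; first exact: Jx.
  by have := congr1 (fun x => coef x (i, r)) (ex _ pj); rewrite coef_idem eqxx.
apply/(epsJP hF); split; first by apply/radJ_free => i; apply: x0; left.
move=> j pj; apply: coef_inj => i r; rewrite coef_idem.
by case: eqP => // jE; apply: x0; right; rewrite jE.
Qed.

(** A path [v] contributes to the coefficient at [u] only if it is a terminal segment of [u]. Among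
    paths of one length this leaves [v = u], which isolates the top coefficient of [m u]; hence the
    fixed length in [good]. *)
Lemma good_free : good free_mod.
Proof.
have hF := is_mod_free.
move=> k j m kL pj m0 i u su iu ej; apply/radJ_free => l; rewrite coef_idem /=.
case: eqP => // ->; have iur : rev_walk i (rev u) by rewrite /rev_walk revK size_rev su kL.
have := congr1 (fun x => coef x (i, rev u)) m0.
rewrite coef_idem -endv_rev revK ej eqxx (islin_sum (coef_lin _)) (islin0 (coef_lin _)).
rewrite (bigD1_seq u) ?uniq_words ?mem_words ?su //= coef_path prefix_refl iur.
rewrite drop_oversize ?size_rev ?leqnn // big1_seq ?addr0 // => v.
rewrite mem_words coef_path iur andbT => /andP[vu /eqP sv].
case: ifP => //; rewrite prefixE size_rev sv take_oversize ?size_rev ?su //.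
by move=> /eqP/(can_inj revK) uv; rewrite uv eqxx in vu.
Qed.

Section Eval.
Variables (X : modData) (hX : is_mod X) (s : V -> X) (s_lin : islin K s).

(** The universal property of the free module: a K-linear [s] prescribes the images of the
    generators, and [idem i] moves them to the right vertex. *)
Definition free_eval (x : free_mod) : X :=
  \sum_i \sum_(r <- allwords A L) pathact (rev r) (idem i (s (coef x (i, r)))).

Lemma free_eval_hom : is_hom free_eval.
Proof.
split.
- move=> c x y; rewrite /free_eval scaler_sumr -big_split; apply: eq_bigr => i _ /=.
  rewrite scaler_sumr -big_split; apply: eq_bigr => r _ /=.
  by rewrite coef_lin s_lin (idem_lin hX) (path_lin hX).
- move=> j x; rewrite /free_eval (islin_sum (idem_lin hX j)); apply: eq_bigr => i _.
  rewrite (islin_sum (idem_lin hX j)); apply: eq_bigr => r _.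
  rewrite coef_idem (path_idem hX) endv_rev.
  have [wr|nw] := boolP (walkb i (rev r)); last by rewrite !(path_nonwalk hX).
  case: eqP => //= _.
  by rewrite (islin0 s_lin) (islin0 (idem_lin hX i)) (islin0 (path_lin hX _)).
- move=> a x; rewrite /free_eval (islin_sum (arr_lin hX a)); apply: eq_bigr => i _.
  rewrite (islin_sum (arr_lin hX a)).
  have z0 w : pathact w (idem i (s 0)) = 0.
    by rewrite (islin0 s_lin) (islin0 (idem_lin hX i)) (islin0 (path_lin hX _)).
  (* Adding an arrow raises lengths by one, so the left sum is extended to words of length L+1,
     where the coefficients vanish. *)
  rewrite -big_allwords_extend => [|r Lr]; last first.
    by rewrite coef_nonpath ?z0 // /rev_walk leqNgt Lr.
  rewrite big_allwords_succ coef_arr_nil z0 add0r (bigD1 a) //=.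
  rewrite [X in _ + X]big1 ?addr0 => [|b ba]; last first.
    by rewrite big1 // => r _; rewrite coef_arr (negPf ba) z0.
  apply: eq_bigr => r _; rewrite coef_arr eqxx rev_cons -cats1 path_cat /=.
  (* The left side is 0. On the right the word is no walk from [i] or exceeds length L, and acts by
     zero in both cases. *)
  case: ifPn => // nar; rewrite z0 (islin0 (arr_lin hX a)).
  change (arr a (pathact (rev r) (idem i (s (coef x (i, r))))))
    with (pathact [:: a] (pathact (rev r) (idem i (s (coef x (i, r)))))).
  rewrite -path_cat cats1 -rev_cons; move: nar; rewrite /rev_walk negb_and.
  case/orP=> [|nw]; last by rewrite (path_nonwalk hX).
  by rewrite -ltnNge => Lr; rewrite (path_long hX) ?size_rev.
Qed.

Lemma free_eval_top x : radJ (free_eval x - \sum_i idem i (s (coef x (i, [::])))).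
Proof.
have HJ := submod_subspace (submod_radJ hX).
rewrite -sumrB; apply: (subspace_sum HJ) => i _.
rewrite (bigD1_seq [::]) ?uniq_allwords ?mem_allwords //= addrAC subrr add0r.
apply: (subspace_sum HJ) => r r0; apply: radJ_path => /(congr1 rev).
by rewrite revK => r0'; rewrite r0' in r0.
Qed.

Lemma free_eval_gen i t : free_eval (free_gen i t) = idem i (s (th i t)).
Proof.
rewrite /free_eval (bigD1 i) //= (bigD1_seq [::]) ?uniq_allwords ?mem_allwords //=.
have z0 j w : pathact w (idem j (s 0)) = 0.
  by rewrite (islin0 s_lin) (islin0 (idem_lin hX j)) (islin0 (path_lin hX _)).
rewrite coef_gen !eqxx /= big1 ?addr0 => [|r r0]; last by rewrite coef_gen (negPf r0) andbF.
rewrite [X in _ + X]big1 ?addr0 // => j ji.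
by rewrite big1 // => r _; rewrite coef_gen (negPf ji).
Qed.

End Eval.

Lemma free_projective : projective K n A src tgt L free_mod.
Proof.
move=> X Y g h hX hY hg gs hh; have [gl ge ga] := hg; have [hl he ha] := hh.
have [s [sl sK]] := exists_section gl gs.
have Gl : islin K (fun t => \sum_i free_gen i t).
  move=> c t u; rewrite scaler_sumr -big_split; apply: eq_bigr => i _; exact: gen_lin.
(* One linear map serves all vertices: [free_eval] applies [idem i], which selects the [i]-th
   generator from the sum. *)
pose q t := s (h (\sum_i free_gen i t)).
have ql : islin K q by move=> c t u; rewrite /q Gl hl sl.
exists (free_eval q); split; first exact: free_eval_hom.
move=> x; rewrite [in RHS](free_expand x) (islin_sum gl) (islin_sum hl).
apply: eq_bigr => i _; rewrite (islin_sum gl) (islin_sum hl).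
apply: eq_bigr => r _; rewrite (hom_path _ _ hg) (hom_path _ _ hh) ge sK -he.
rewrite (islin_sum (idem_lin is_mod_free i)).
rewrite (eq_bigr _ (fun j _ => idem_gen j i (coef x (i, r)))).
by rewrite -big_mkcond big_pred1_eq.
Qed.

End Free.

Notation LamE := (LamE K n A src tgt L).


(* Lambda e_i is the free module on a line placed at the vertex i. *)
Section LambdaE.
Variable i : 'I_n.

Definition vertex_proj (j : 'I_n) (c : K^o) : K^o := if j == i then c else 0.

Lemma vertex_proj_lin j : islin K (vertex_proj j).
Proof. by move=> c x y; rewrite /vertex_proj; case: eqP => // _; rewrite scaler0 addr0. Qed.

Lemma vertex_proj_id j c : vertex_proj j (vertex_proj j c) = vertex_proj j c.
Proof. by rewrite /vertex_proj; case: eqP. Qed.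

Definition pathval (z : LamE i) (w : seq A) : K^o :=
  if insub w is Some w' then (z : {ffun PW n A src tgt L i -> K^o}) w' else 0.

Lemma mem_pathsFrom w : (w \in pathsFrom n A src tgt L i) = rev_walk i (rev w).
Proof. by rewrite mem_filter mem_allwords /rev_walk size_rev revK andbC. Qed.

Lemma pathval_idem j z w :
  pathval (idem j z) w = if endv i w == j then pathval z w else 0.
Proof. by rewrite /pathval; case: insubP => [u _ <-|_]; rewrite ?ffunE ?if_same. Qed.

Lemma pathval_arr_nil a z : pathval (arr a z) [::] = 0.
Proof. by rewrite /pathval; case: insubP => [u _ uw|//]; rewrite ffunE /= uw. Qed.

Lemma pathval_arr a z w b : pathval (arr a z) (rcons w b) =
  if (b == a) && rev_walk i (rev (rcons w b)) then pathval z w else 0.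
Proof.
rewrite /pathval -mem_pathsFrom; case: insubP => [u -> uw|/negPf ->]; last by rewrite andbF.
by rewrite ffunE /= uw /lastA rev_rcons /= andbT /dropLast size_rcons /= -cats1 take_size_cat //.
Qed.

Lemma LamE_iso :
  exists (f : LamE i -> free_mod vertex_proj_lin) (g : free_mod vertex_proj_lin -> LamE i),
  [/\ is_hom f, is_hom g, cancel f g & cancel g f].
Proof.
pose c (z : LamE i) (p : 'I_n * seq A) : K^o := if p.1 == i then pathval z (rev p.2) else 0.
have cP z : free_coef vertex_proj (c z).
  move=> j r; rewrite /vertex_proj /c /=; split; first by case: eqP.
  move=> nr; case: eqP nr => // ->; rewrite -{1}(revK r) -mem_pathsFrom => nr.
  by rewrite /pathval insubN.
have [f fE] := choice (fun z => exists_coef vertex_proj_lin (cP z)).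
pose g (x : free_mod vertex_proj_lin) : LamE i :=
  [ffun w : PW n A src tgt L i => coef x (i, rev (ssval w))].
have fK : cancel f g.
  move=> z; apply/ffunP => w; rewrite ffunE fE /c /= eqxx revK /pathval.
  by rewrite insubT ?ssvalP // => wP; congr (_ _); apply: val_inj.
have gK : cancel g f.
  move=> x; apply: coef_inj => j r; rewrite fE /c /=; case: (j =P i) => [->|/eqP/negPf ji].
    rewrite /pathval; case: insubP => [u _ uE|]; first by rewrite ffunE uE revK.
    by rewrite mem_pathsFrom revK => nr; rewrite coef_nonpath.
  by rewrite -(coef_th x) /vertex_proj ji.
have hf : is_hom f.
  split=> [d y z|j z|a z]; apply: coef_inj => l r.
  - rewrite coef_lin !fE /c /=; case: eqP => _; last by rewrite scaler0 addr0.
    by rewrite /pathval; case: insubP => [u _ _|_]; rewrite ?ffunE // scaler0 addr0.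
  - rewrite coef_idem !fE /c /=; case: eqP => [->|_]; last by rewrite if_same.
    by rewrite pathval_idem endv_rev.
  - case: r => [|b r]; first by rewrite coef_arr_nil fE /c /= pathval_arr_nil if_same.
    rewrite coef_arr !fE /c /=; case: eqP => [->|_]; last by rewrite if_same.
    by rewrite rev_cons pathval_arr -rev_cons revK.
have [fl fe fa] := hf; exists f, g; split=> //.
by split=> [d x y|j x|a x]; apply: (can_inj fK); rewrite ?fl ?fe ?fa !gK.
Qed.

Lemma is_mod_LamE : is_mod (LamE i).
Proof.
have [f [g [hf _ fK _]]] := LamE_iso.
exact: is_mod_inj (is_mod_free vertex_proj_lin) hf (can_inj fK).
Qed.

Lemma good_LamE : good (LamE i).
Proof.
have [f [g [hf hg fK _]]] := LamE_iso.
apply: (good_summand hg hf fK); exact: good_free vertex_proj_id.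
Qed.

Lemma exists_LamE_generator : exists d : LamE i, idem i d = d /\ ~ radJ d.
Proof.
have [f [g [hf [gl ge ga] fK gK]]] := LamE_iso.
exists (g (free_gen vertex_proj_lin vertex_proj_id i 1)); split.
  by rewrite -ge idem_gen eqxx.
move/(hom_radJ hf); rewrite gK => /(radJ_free vertex_proj_id)/(_ i)/eqP.
by rewrite coef_gen eqxx /= /vertex_proj eqxx oner_eq0.
Qed.

(** [h] reads off the coefficient of the trivial path; it is the quotient map from Lambda e_i onto
    S_i, realized on K. *)
Lemma LamE_top_coef : exists h : LamE i -> K, [/\ islin K (h : LamE i -> K^o),
  forall j z, h (idem j z) = if j == i then h z else 0, forall a z, h (arr a z) = 0,
  (forall c, exists z, h z = c) & forall z, h z = 0 <-> radJ z].
Proof.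
have [f [g [hf hg fK gK]]] := LamE_iso; have [fl fe fa] := hf.
exists (fun z => coef (f z) (i, [::])); split.
- by move=> c x y; rewrite fl.
- by move=> j z; rewrite fe coef_idem eq_sym.
- by move=> a z; rewrite fa.
- move=> c; exists (g (free_gen vertex_proj_lin vertex_proj_id i c)).
  by rewrite gK coef_gen eqxx /= /vertex_proj eqxx.
move=> z; split=> [z0|Jz].
  rewrite -[z]fK; apply: hom_radJ hg _.
  apply/(radJ_free vertex_proj_id) => j.
  by rewrite -coef_th /vertex_proj; case: eqP => // ->.
by move/(hom_radJ hf)/(radJ_free vertex_proj_id): Jz; exact.
Qed.

End LambdaE.

(** * Composition factors and the vertices of a module *)

Lemma comp_factor_vertex (P : modData) (hP : is_mod P) (N : P -> Prop) j y :
  submod N -> N y -> idem j y = y -> y <> 0 -> comp_factor K n A src tgt L N j.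
Proof.
move=> HN Ny jy y0; have [N0 Nl Ne Na] := HN.
(* [V] is Jy, as the smallest submodule containing all [arr a y]. With U = Ky + V, which is Lambda
   y, the quotient U/V is the simple module at [j]. *)
pose V v := forall W : P -> Prop, submod W -> (forall a, W (arr a y)) -> W v.
have HV : submod V.
  split=> [W [W0 _ _ _] //|c u v Vu Vv W HW Wa|i v Vv W HW Wa|a v Vv W HW Wa];
    have [W0 Wl We WA] := HW; [apply: Wl|apply: We|apply: WA]; by [apply: Vu|apply: Vv].
have HVs := submod_subspace HV.
have VN v : V v -> N v by move/(_ N HN); apply=> a; exact: Na.
have nVy : ~ V y.
  (* [W k] consists of the elements whose components are killed by all paths of length at least [k].
     If [y] were in Jy, it would descend from [W L.+1] to [W 0], hence be zero. *)
  move=> Vy; pose W k v := forall w i, (k <= size w)%N -> pathact w (idem i (v : P)) = 0.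
  have HW k : submod (W k).
    split=> [w i _|c u v Wu Wv w i kw|l v Wv w i kw|a v Wv w i kw].
    - by rewrite (islin0 (idem_lin hP i)) (islin0 (path_lin hP w)).
    - by rewrite (idem_lin hP) (path_lin hP) Wu // Wv // scaler0 addr0.
    - rewrite (idem_idem hP); case: eqP => // _; first exact: Wv.
      exact: islin0 (path_lin hP w).
    - rewrite (idem_arr hP); case: eqP => // _; last exact: islin0 (path_lin hP w).
      rewrite -(sum_idem hP v) (islin_sum (arr_lin hP a)) (islin_sum (path_lin hP w)).
      by apply: big1 => l _; exact: (Wv (a :: w)) (leqW kw).
  have WS k : W k.+1 y -> W k y.
    move=> Wy; apply: (Vy (W k) (HW k)) => a w i kw.
    rewrite (idem_arr hP); case: eqP => // _; last exact: islin0 (path_lin hP w).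
    by have := Wy (a :: w) j kw; rewrite jy.
  have WL : W L.+1 y by move=> w i Lw; rewrite (path_long hP).
  have W0y : W 0%N y by elim: L.+1 WL => // k IH /WS.
  by apply: y0; rewrite -jy; exact: (W0y [::] j).
have [h [hl hV hy]] := exists_functional HVs nVy.
pose U u := exists c v, V v /\ u = c *: y + v.
have hU c v : V v -> h (c *: y + v) = c by move=> Vv; rewrite hl hy hV // mulr1 addr0.
pose X := @ModData K n A K^o (fun i x => if i == j then x else 0) (fun a x => 0).
exists U, V; split=> //.
- split.
  + by exists 0, 0; split; [exact: HVs.1|rewrite scale0r addr0].
  + move=> c _ _ [d [u [Vu ->]]] [e [v [Vv ->]]]; exists (c * d + e), (c *: u + v).
    by split; [exact: HVs.2|rewrite scalerDr scalerA addrACA -scalerDl].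
  + move=> i _ [c [v [Vv ->]]]; have [_ _ Ve _] := HV.
    rewrite (idem_lin hP) -jy (idem_idem hP); case: eqP => [->|_].
      by exists c, (idem j v); split=> //; [exact: Ve|rewrite jy].
    exists 0, (idem i v); split; first exact: Ve.
    by rewrite scaler0 scale0r.
  + move=> a _ [c [v [Vv ->]]]; have [_ _ _ Va] := HV.
    exists 0, (arr a (c *: y + v)); split; last by rewrite scale0r add0r.
    rewrite (arr_lin hP); apply: HVs.2; last exact: Va.
    by move=> W _; exact.
- by move=> v Vv; exists 0, v; rewrite scale0r add0r.
- by move=> _ [c [v [Vv ->]]]; apply: Nl => //; exact: VN.
have [psi [pl pe pa ps p0]] := LamE_top_coef j.
have hX : @Defs.is_hom K n A (LamE j) X psi by split.
exists X, h, psi; split=> //.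
- exact: is_mod_surj (is_mod_LamE j) hX ps.
- split=> [c u v _ _|i _ [c [v [Vv ->]]]|a _ [c [v [Vv ->]]]]; first exact: hl.
    have [_ _ Ve _] := HV; rewrite hU // (idem_lin hP) -jy (idem_idem hP) /=.
    case: eqP => [->|_]; first by rewrite jy hU //; exact: Ve.
    by rewrite scaler0 add0r hV //; exact: Ve.
  have [_ _ _ Va] := HV; apply: hV; rewrite (arr_lin hP); apply: HVs.2; last exact: Va.
  by move=> W _; exact.
- move=> c; exists (c *: y); split; last by rewrite -[c *: y]addr0 hU //; exact: HVs.1.
  by exists c, 0; split; [exact: HVs.1|rewrite addr0].
- move=> _ [c [v [Vv ->]]]; rewrite hU //; split=> [->|]; first by rewrite scale0r add0r.
  by move/hV; rewrite hU.
Qed.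

Lemma comp_factor_idem (P : modData) (hP : is_mod P) (N : P -> Prop) i :
  comp_factor K n A src tgt L N i -> exists2 x, N x & idem i x <> 0.
Proof.
case=> U [V [HU HV VU UN [X [phi [psi [hX hphi sphi kphi [hpsi spsi kpsi]]]]]]].
have [phil phie phia] := hphi; have [psil psie psia] := hpsi.
have [d [id_d nJd]] := exists_LamE_generator i.
have [u [Uu uE]] := sphi (psi d); exists u; first exact: UN.
move=> u0; apply/nJd/kpsi; rewrite -id_d psie -uE -phie // u0.
by apply/kphi; case: HV; case: HU.
Qed.


(** * Projective covers *)

(** [th i] is [idem i] after the projection onto the span of [B] along JM. Each vector of [B] sits
    at one vertex, so that span is stable under the idempotents, and [th i] is idempotent with
    values in a complement of JM. *)
Lemma exists_top_basis (M : modData) (hM : is_mod M) :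
  exists (B : M -> Prop) (th : 'I_n -> M -> M),
  [/\ forall b, B b -> exists i, idem i b = b, indep_mod (radJ : M -> Prop) B,
      forall x, exists2 y, spanned B y & radJ (x - y),
      forall i, islin K (th i) & forall i x, th i (th i x) = th i x] /\
  [/\ forall i x, idem i (th i x) = th i x,
      forall i b, B b -> th i b = idem i b,
      forall x, radJ (x - \sum_i th i x) &
      forall i x, radJ (th i x) -> th i x = 0].
Proof.
have HJ := submod_subspace (submod_radJ hM).
have [B [Bh iB sB]] := exists_basis_mod (fun b : M => exists i, idem i b = b) HJ.
have {}sB x : exists2 y, spanned B y & radJ (x - y).
  have H i : exists y, spanned B y /\ radJ (idem i x - y).
    by have [|y By Jy] := sB (idem i x); [exists i; exact: (idem_id hM)|exists y].
  have [y yP] := choice H; exists (\sum_i y i).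
    by apply: (subspace_sum (subspace_spanned B)) => i _; have [] := yP i.
  rewrite -{1}(sum_idem hM x) -sumrB.
  by apply: (subspace_sum HJ) => i _; have [] := yP i.
have [p [pl pB p0 pJ pid]] := projection_mod_basis HJ iB sB.
have Bidem i x : spanned B x -> spanned B (idem i x).
  case=> s [sP ->]; rewrite (islin_sum (idem_lin hM i)).
  apply: (subspace_sum_seq (subspace_spanned B)) => t ts.
  rewrite (islinZ (idem_lin hM i)); apply: (subspace_scale (subspace_spanned B)).
  have Bt := sP t ts; have [l tl] := Bh _ Bt; rewrite -tl (idem_idem hM).
  by case: eqP => _; [rewrite tl; exact: spanned_self|exact: (subspace_spanned B).1].
exists B, (fun i x => idem i (p x)); split; split=> //.
- by move=> i c x y; rewrite pl (idem_lin hM).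
- by move=> i x; rewrite (pid (idem i (p x))) ?(idem_id hM) //; exact: Bidem.
- by move=> i x; rewrite (idem_id hM).
- by move=> i b Bb; rewrite pid //; exact: spanned_self.
- by move=> x; rewrite (sum_idem hM).
- by move=> i x; apply: (indep_mod_spanned iB); exact: Bidem.
Qed.

Section TopCover.
Variables (M : modData) (hM : is_mod M) (th : 'I_n -> M -> M).
Hypotheses (th_lin : forall i, islin K (th i)) (th_id : forall i x, th i (th i x) = th i x).
Hypotheses (idem_th : forall i x, idem i (th i x) = th i x)
  (th_top : forall x, radJ (x - \sum_i th i x))
  (th_radJ : forall i x, radJ (th i x) -> th i x = 0).

(* Lambda (x) T -> M for a complement T = (+)_i th_i M of JM in M *)
Definition top_cover : free_mod th_lin -> M := free_eval (fun x => x).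

Let hF : is_mod (free_mod th_lin) := is_mod_free th_lin.

Lemma top_cover_hom : is_hom top_cover.
Proof. by apply: free_eval_hom. Qed.

Lemma top_cover_radJ x : radJ (top_cover x) -> radJ x.
Proof.
move=> Jx; apply/(radJ_free th_id) => i; have [J0 Jl Je Ja] := submod_radJ hM.
have : radJ (idem i (\sum_l idem l (coef x (l, [::])))).
  apply: Je; rewrite -[\sum_l _](subKr (top_cover x)).
  apply: (subspace_sub (submod_subspace (submod_radJ hM))) => //.
  by apply: free_eval_top.
rewrite (islin_sum (idem_lin hM i)) (eq_bigr _ (fun l _ => idem_idem hM i l _)).
rewrite -big_mkcond (big_pred1 i) => [|l]; last by rewrite eq_sym.
by rewrite -coef_th idem_th; exact: th_radJ.
Qed.

Lemma top_cover_gen i t : top_cover (free_gen th_lin th_id i t) = th i t.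
Proof. by rewrite /top_cover free_eval_gen // idem_th. Qed.

Lemma top_cover_surj : Defs.surj top_cover.
Proof.
have [fl fe fa] := top_cover_hom.
apply: (nakayama hM (submod_hom_image top_cover_hom)) => x.
exists (\sum_i th i x) => //; exists (\sum_i free_gen th_lin th_id i x).
by rewrite (islin_sum fl); apply: eq_bigr => i _; rewrite top_cover_gen.
Qed.

Lemma top_cover_kernel x : top_cover x = 0 -> radJ x.
Proof. by move=> x0; apply: top_cover_radJ; rewrite x0; have [] := submod_radJ hM. Qed.

Lemma top_cover_proj_cover : proj_cover K n A src tgt L top_cover.
Proof.
split; [exact: hF|exact: free_projective th_id|exact: top_cover_hom|exact: top_cover_surj|].
move=> U HU gen; apply: (nakayama hF HU) => x.
have [u [k [Uu [k0 ->]]]] := gen x; exists u => //.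
by rewrite addrC addKr; exact: top_cover_kernel.
Qed.

(** Together with [hom_epsJ] this identifies M/(epsilon J M), for good M, with the same quotient of
    a free module, where coefficients can be read off. *)
Lemma good_top_cover_epsJ x : good M -> epsJ (top_cover x) -> epsJ x.
Proof.
have [fl fe fa] := top_cover_hom.
move=> gM /(epsJP hM)[Jx ex]; apply/(epsJP hF); split; first exact: top_cover_radJ.
move=> j pj; rewrite -(idem_id hF); apply: (good_kernel hF hM top_cover_hom) => //.
- exact: top_cover_surj.
- exact: top_cover_kernel.
- by rewrite fe ex.
Qed.

End TopCover.

Lemma exists_proj_cover (M : modData) (hM : is_mod M) :
  exists (P : modData) (f : P -> M), proj_cover K n A src tgt L f /\ good P.
Proof.
have [B [th [[_ _ _ tl ti] [ie tb ttop tJ]]]] := exists_top_basis hM.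
exists (free_mod tl), (top_cover (th_lin := tl)); split; first exact: top_cover_proj_cover.
exact: good_free ti.
Qed.

(** * Finite projective dimension *)

Lemma projective_good (P : modData) : is_mod P -> projective K n A src tgt L P -> good P.
Proof.
move=> hP pP; have [C [f [[hC _ hf fs _] gC]]] := exists_proj_cover hP.
have hid : @Defs.is_hom K n A P P id by split.
have [k [hk kK]] := pP C P f id hC hP hf fs hid.
exact: good_summand hf hk kK gC.
Qed.

Lemma fin_pd_good (M : modData) : is_mod M -> fin_pd K n A src tgt L M -> good M.
Proof.
move=> hM [k pdM]; elim: pdM hM => [{}k {}M pM hM|]; first exact: projective_good.
move=> {}k {}M P Z f g hP hZ pP hf fs hg gi exa _ gZ hM.
by apply: (good_extension hM hP hZ hf fs hg gi exa); [exact: projective_good|exact: gZ].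
Qed.

Lemma good_kernel_nonprecyclic (M : modData) : is_mod M -> good M ->
  kernel_nonprecyclic K n A src tgt L M.
Proof.
move=> hM gM P f Pf i cf pi; have [hP _ hf fs _] := Pf.
have [x fx] := comp_factor_idem hP cf; apply.
apply: (good_kernel hP hM hf fs) => // y; exact: (proj_cover_radJ hM Pf).
Qed.

(** A measure that drops along every nonempty walk from a nonprecyclic vertex: the end of the walk
    is reachable from the start but, for want of cycles, not from itself. *)
Definition reach (i : 'I_n) : nat :=
  #|[pred j | `[< exists w, [/\ w <> [::], walkb i w & endv i w = j] >]]|.

Lemma reach_lt i w : ~ precyclic i -> w <> [::] -> walkb i w -> (reach (endv i w) < reach i)%N.
Proof.
move=> npi w0 iw; apply: proper_card; apply/properP; split.
  apply/fintype.subsetP => j /asboolP[v [v0 jv jE]]; apply/asboolP; exists (w ++ v).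
  rewrite walkb_cat iw endv_cat; split=> // /nilP.
  by rewrite /nilp size_cat addn_eq0 => /andP[/nilP].
exists (endv i w); first by apply/asboolP; exists w.
apply/negP => /asboolP[v [v0 jv jE]]; apply: npi; exists w, (endv i w).
by split; [split|exists v; split=> //; split].
Qed.

Lemma nonprecyclic_pd_le N (Z : modData) : is_mod Z ->
  (forall i (z : Z), idem i z <> 0 -> ~ precyclic i /\ (reach i < N)%N) ->
  pd_le K n A src tgt L N Z.
Proof.
(* No vertex satisfies [reach i < 0], so the induction starts at Z = 0, which is projective. *)
elim: N Z => [|N IH] Z hZ supp.
  have Z0 (z : Z) : z = 0.
    rewrite -(sum_idem hZ z) big1 // => i _; apply: contrapT => iz.
    by have [] := supp i z iz.
  apply: pd_proj => X Y g h hX hY [gl _ _] gs [hl _ _].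
  exists (fun=> 0); split; last by move=> z; rewrite (islin0 gl) (Z0 z) (islin0 hl).
  split=> [c x y|i x|a x]; first by rewrite scaler0 addr0.
    by rewrite (islin0 (idem_lin hX i)).
  by rewrite (islin0 (arr_lin hX a)).
have [B [th [[_ _ _ tl ti] [ie tb ttop tJ]]]] := exists_top_basis hZ.
have [hF pF hf fs _] := top_cover_proj_cover hZ tl ti ie ttop tJ.
have [Z' [g [hZ' hg gi gE]]] := exists_submodule hF (submod_hom_kernel hZ hf).
apply: (pd_step K n A src tgt L N Z _ Z' (top_cover (th_lin := tl)) g) => //.
(* The kernel of the cover lies in the radical, so a nonzero coefficient belongs to a nontrivial
   path. It starts in the support of Z and ends at [j], so [reach] has dropped. *)
apply: IH => // j z' jz'; have [gl ge ga] := hg.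
have /(top_cover_kernel hZ ti ie tJ)/(radJ_free ti) top0 : top_cover (g z') = 0.
  by apply/gE; exists z'.
have [i [r [ij x0]]] : exists i r, rev_end i r = j /\ coef (g z') (i, r) <> 0.
  apply: contrapT => H; apply: jz'; apply: gi; rewrite ge (islin0 gl).
  apply: coef_inj => i r; rewrite coef_idem; case: eqP => // ij.
  by apply: contrapT => x0; apply: H; exists i, r.
have r0 : rev r <> [::] by move/(congr1 rev); rewrite revK => r0; rewrite r0 top0 in x0.
have ir : walkb i (rev r).
  by apply: contra_notT x0 => nir; rewrite coef_nonpath // /rev_walk (negPf nir) andbF.
have [npi ri] : ~ precyclic i /\ (reach i < N.+1)%N.
  by apply: (supp i (coef (g z') (i, r))); rewrite -(coef_th _ i r) ie coef_th.
have jE : endv i (rev r) = j by rewrite endv_rev.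
split; first by move=> pj; apply/npi/(precyclic_walk ir); rewrite jE.
by rewrite -jE; apply: leq_trans (reach_lt npi r0 ir) ri.
Qed.

Lemma kernel_nonprecyclic_fin_pd (M : modData) : is_mod M ->
  kernel_nonprecyclic K n A src tgt L M -> fin_pd K n A src tgt L M.
Proof.
move=> hM np; have [P [f [Pf _]]] := exists_proj_cover hM.
have [hP pP hf fs _] := Pf; have [fl fe fa] := hf.
have HU := submod_hom_kernel hM hf.
have [Z [g [hZ hg gi gE]]] := exists_submodule hP HU; have [gl ge ga] := hg.
(* [reach] is at most [n], hence below [n.+1], which bounds the dimension of the kernel; the cover
   adds one. *)
exists n.+2; apply: (pd_step K n A src tgt L _ M P Z f g) => //.
apply: nonprecyclic_pd_le => // i z iz; split; last first.
  by rewrite ltnS /reach -[X in (_ <= X)%N]card_ord max_card.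
apply: (np P f Pf); apply: (comp_factor_vertex hP HU (y := idem i (g z))).
- by apply/gE; exists (idem i z).
- exact: (idem_id hP).
- by rewrite -ge => giz; apply: iz; apply: gi; rewrite giz (islin0 gl).
Qed.


(** * Decomposition into local modules *)

(** The part of the free module attached to the single vector [b] at the vertex [i]. The scalars [a]
    are recorded so that independence of several such [b] can be applied path by path. *)
Lemma exists_local_cover (M : modData) (th : 'I_n -> M -> M)
    (th_lin : forall i, islin K (th i)) (th_id : forall i x, th i (th i x) = th i x) i b :
  th i b = b ->
  exists (f : LamE i -> free_mod th_lin) (a : LamE i -> 'I_n * seq A -> K),
  [/\ is_hom f, forall z j r, coef (f z) (j, r) = a z (j, r) *: b,
      exists z, f z = free_gen th_lin th_id i b &
      forall z, (forall j r, r = [::] \/ precyclic (rev_end j r) -> a z (j, r) = 0) -> epsJ z].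
Proof.
move=> ib; have hF := is_mod_free th_lin.
have [f [g [hf hg fK gK]]] := LamE_iso i; have [fl fe fa] := hf.
have hE := is_mod_free (vertex_proj_lin i).
have cP z : free_coef th (fun p => coef (f z) p *: b).
  move=> j r; split; last by move=> nr; rewrite coef_nonpath // scale0r.
  rewrite (islinZ (th_lin j)); have [->|ji] := eqVneq j i; first by rewrite ib.
  by rewrite -coef_th /vertex_proj (negPf ji) !scale0r.
have [h hE'] := choice (fun z => exists_coef th_lin (cP z)).
exists h, (fun z => coef (f z)); split.
- split=> [c x y|j x|c x]; apply: coef_inj => l r.
  + by rewrite coef_lin !hE' fl coef_lin scalerDl scalerA.
  + by rewrite coef_idem !hE' fe coef_idem; case: eqP; rewrite ?scale0r.
  + case: r => [|d r]; first by rewrite coef_arr_nil hE' fa coef_arr_nil scale0r.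
    by rewrite coef_arr !hE' fa coef_arr; case: ifP; rewrite ?scale0r.
- by move=> z j r; rewrite hE'.
- exists (g (free_gen (vertex_proj_lin i) (vertex_proj_id i) i 1)).
  apply: coef_inj => j r; rewrite hE' gK !coef_gen /vertex_proj eqxx.
  by case: ifP => _; rewrite ?scale1r ?scale0r ?ib.
- move=> z z0; rewrite -[z]fK; apply: (hom_epsJ hE (is_mod_LamE i) hg).
  by apply/(epsJ_free (vertex_proj_id i)) => j r; exact: z0.
Qed.

Lemma good_dsum_copies (M : modData) : is_mod M -> good M -> dsum_copies K n A src tgt L M.
Proof.
move=> hM gM; have [B [th [[Bh iB sB tl ti] [ie tb ttop tJ]]]] := exists_top_basis hM.
have [X [phi [hX hphi sphi kphi]]] := exists_quotient hM (submod_epsJ hM).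
exists X, phi; split=> //; have [pl pe pa] := hphi.
pose T : eqType := {b : M | `[< B b >]}.
have TB (t : T) : B (val t) by apply/asboolP; exact: (valP t).
have [c cE] := choice (fun t : T => Bh _ (TB t)).
have thc (t : T) : th (c t) (val t) = val t by rewrite tb.
pose F := free_mod tl; pose f : F -> M := top_cover (th_lin := tl).
have hf : is_hom f := top_cover_hom hM tl; have [fl fe fa] := hf.
pose rho t := projT1 (cid (exists_local_cover tl ti (thc t))).
have [a aP] : exists a : forall t, LamE (c t) -> 'I_n * seq A -> K, forall t,
    [/\ is_hom (rho t), forall z j r, coef (rho t z) (j, r) = a t z (j, r) *: val t,
      exists z, rho t z = free_gen tl ti (c t) (val t) &
      forall z, (forall j r, r = [::] \/ precyclic (rev_end j r) -> a t z (j, r) = 0) -> epsJ z].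
  pose aex t := projT2 (cid (exists_local_cover tl ti (thc t))).
  by exists (fun t => projT1 (cid (aex t))) => t; exact: projT2 (cid (aex t)).
have hrho t : is_hom (rho t) by have [] := aP t.
have hpsi t : is_hom (phi \o (f \o rho t)) by do 2?apply: hom_comp.
have fgen t : exists z, f (rho t z) = val t.
  have [_ _ [z zE] _] := aP t; exists z; rewrite zE.
  exact: etrans (top_cover_gen hM tl ti ie _ _) (thc t).
have phi_eps x : epsJ x -> phi (f x) = 0.
  by move=> ex; apply/kphi; exact: (hom_epsJ (is_mod_free tl) hM hf ex).
(* By goodness a relation in M/(epsilon J M) lifts to the free module modulo epsilon J. Its
   coefficient at a trivial path, or at a path to a precyclic vertex, is a linear relation among
   basis vectors, hence trivial. *)
have indep (I : eqType) (s : seq I) (t : I -> T) (y : I -> F) (d : I -> 'I_n * seq A -> K) :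
    uniq [seq t i | i <- s] ->
    (forall i, i \in s -> forall j r, coef (y i) (j, r) = d i (j, r) *: val (t i)) ->
    \sum_(i <- s) phi (f (y i)) = 0 ->
    forall i, i \in s -> forall j r, r = [::] \/ precyclic (rev_end j r) -> d i (j, r) = 0.
  move=> us yd; rewrite -(islin_sum pl) -(islin_sum fl) => /kphi.
  move/(good_top_cover_epsJ hM ti ie ttop tJ gM)/(epsJ_free ti) => y0 i si j r jr.
  apply: (indep_mod_family (b := val \o t) (a := fun i => d i (j, r)) iB) si => [|l _|].
  - by rewrite (map_comp val t) map_inj_uniq //; exact: val_inj.
  - exact: TB.
  - have := y0 j r jr; rewrite (islin_sum (coef_lin (j, r))) => E.
    rewrite [X in radJ X](_ : _ = 0); first by have [] := submod_radJ hM.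
    by rewrite -[RHS]E; apply: eq_big_seq => l ls; rewrite yd.
exists T, c, (fun t x => exists z, phi (f (rho t z)) = x); split.
- by move=> t; exact: submod_hom_image (hpsi t).
- move=> t; exists (phi \o (f \o rho t)); split=> // z; split=> [z0|ez]; last first.
    by apply: phi_eps; exact: (hom_epsJ (is_mod_LamE (c t)) (is_mod_free tl) (hrho t) ez).
  have [_ ra _ rep] := aP t; apply: rep => j r.
  apply: (indep unit [:: tt] (fun=> t) (fun=> rho t z) (fun=> a t z) _ _ _ tt) => //.
  by rewrite big_seq1.
(* [W] is the preimage of the sum of the local modules; it contains the basis of M modulo JM, so
   Nakayama's lemma gives all of M. *)
- pose W m := exists s : seq (T * X),
    (forall p, p \in s -> exists z, phi (f (rho p.1 z)) = p.2) /\ phi m = \sum_(p <- s) p.2.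
  have HW : submod W.
    split.
    + by exists [::]; rewrite big_nil (islin0 pl).
    + move=> e x y [s [sP xE]] [u [uP yE]].
      exists ([seq (p.1, e *: p.2) | p <- s] ++ u); split.
        move=> p; rewrite mem_cat => /orP[/mapP[q qs ->] /=|]; last exact: uP.
        have [z <-] := sP q qs; have [hl _ _] := hpsi q.1.
        by exists (e *: z); exact: (islinZ hl).
      by rewrite pl xE yE big_cat big_map scaler_sumr.
    + move=> i x [s [sP xE]]; exists [seq (p.1, idem i p.2) | p <- s]; split.
        move=> p /mapP[q qs ->] /=; have [z <-] := sP q qs; have [_ he _] := hpsi q.1.
        by exists (idem i z); exact: he.
      by rewrite pe xE (islin_sum (idem_lin hX i)) big_map.
    + move=> e x [s [sP xE]]; exists [seq (p.1, arr e p.2) | p <- s]; split.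
        move=> p /mapP[q qs ->] /=; have [z <-] := sP q qs; have [_ _ ha] := hpsi q.1.
        by exists (arr e z); exact: ha.
      by rewrite pa xE (islin_sum (arr_lin hX e)) big_map.
  have WT : forall m, W m.
    apply: (nakayama hM HW) => x; have [_ [s [sP ->]] Jy] := sB x.
    exists (\sum_(p <- s) p.1 *: p.2) => //; have HWs := submod_subspace HW.
    apply: (subspace_sum_seq HWs) => p ps; apply: (subspace_scale HWs).
    have /asboolP Bp := sP p ps; pose t : T := exist _ p.2 Bp.
    have [z zE] := fgen t; exists [:: (t, phi p.2)]; rewrite big_seq1; split=> // q.
    by rewrite inE => /eqP ->; exists z; rewrite zE.
  by move=> x; have [m <-] := sphi x; exact: WT.
- move=> s us sP s0 p ps.
  have H q : exists yd : F * ('I_n * seq A -> K), q \in s ->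
      [/\ forall j r, coef yd.1 (j, r) = yd.2 (j, r) *: val q.1, phi (f yd.1) = q.2 &
       (forall j r, r = [::] \/ precyclic (rev_end j r) -> yd.2 (j, r) = 0) -> q.2 = 0].
    have [qs|] := boolP (q \in s); last by exists (0, fun=> 0).
    have [z zE] := sP q qs; exists (rho q.1 z, a q.1 z) => _ /=.
    have [_ ra _ rep] := aP q.1; split=> // H; rewrite -zE; apply: phi_eps.
    exact: (hom_epsJ (is_mod_LamE (c q.1)) (is_mod_free tl) (hrho q.1) (rep z H)).
  have [yd ydP] := choice H; have [_ _] := ydP p ps; apply.
  apply: (indep _ s fst (fun q => (yd q).1) (fun q => (yd q).2)) => //.
    by move=> q qs; have [] := ydP q qs.
  by rewrite -[RHS]s0; apply: eq_big_seq => q qs; have [_ -> _] := ydP q qs.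
Qed.

(** Goodness can be tested in the quotient X, as the kernel of [phi] lies in JM. Directness splits a
    relation into components, and each lifts to a relation in some Lambda e_i because epsilon J e_i
    vanishes at the precyclic vertex [j]. *)
Lemma dsum_copies_good (M : modData) : is_mod M -> dsum_copies K n A src tgt L M -> good M.
Proof.
move=> hM [X [phi [hX hphi sphi kphi [T [c [U [HU UE gen ind]]]]]]].
have [pl pe pa] := hphi; move=> k j m kL pj m0 i u su iu ej.
suff JX : radJ (phi (idem i (m u))).
  apply: (radJ_lift hM hX hphi) => // y /kphi ey.
  by have [] := (epsJP hM y).1 ey.
(* [xi] records the components of an element with a finite list carrying them, so that the elements
   for all words of length [k] can share one index list [ts]. *)
have H x : exists xi : (T -> X) * seq T, (forall t, U t (xi.1 t)) /\
    forall ts, uniq ts -> {subset xi.2 <= ts} -> x = \sum_(t <- ts) xi.1 t.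
  have [s [sP ->]] := gen x.
  exists (fun t => \sum_(p <- s | p.1 == t) p.2, [seq p.1 | p <- s]); split=> [t|ts uts sub] /=.
    rewrite big_seq_cond; apply: (subspace_sum (submod_subspace (HU t))) => p.
    by case/andP=> ps /eqP <-; exact: sP.
  by apply: sum_regroup => //; apply/allP => p ps; apply/sub/map_f.
have [xi xiP] := choice H; pose x v := xi (phi (m v)).
pose ts := undup (flatten [seq (x v).2 | v <- words A k]).
have xE v : size v = k -> phi (m v) = \sum_(t <- ts) (x v).1 t.
  move=> sv; have [_] := xiP (phi (m v)); apply; first exact: undup_uniq.
  move=> t tv; rewrite mem_undup; apply/flattenP; exists (x v).2 => //.
  by apply/mapP; exists v; rewrite ?mem_words ?sv.
pose y t := idem j (\sum_(v <- words A k) pathact v ((x v).1 t)).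
have Uy t : U t (y t).
  have [_ _ Ue _] := HU t; apply/Ue/(subspace_sum (submod_subspace (HU t))) => v _.
  by apply: submod_path => //; have [] := xiP (phi (m v)).
have y0 t : t \in ts -> y t = 0.
  move=> tts; apply: (ind [seq (t, y t) | t <- ts] _ _ _ (t, y t)).
  - by rewrite -map_comp map_id undup_uniq.
  - by move=> _ /mapP[l _ ->]; exact: Uy.
  - rewrite big_map -[RHS](islin0 pl) -m0 pe (islin_sum pl) -(islin_sum (idem_lin hX j)).
    rewrite exchange_big; congr (idem j _); apply: eq_big_seq => v; rewrite mem_words => /eqP sv.
    by rewrite (hom_path _ _ hphi) xE // (islin_sum (path_lin hX v)).
  - exact: map_f.
have HJ := submod_radJ hX; have [_ _ Je _] := HJ.
rewrite pe xE // (islin_sum (idem_lin hX i)).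
apply: (subspace_sum_seq (submod_subspace HJ)) => t tts.
have [psi [hpsi psiU psi0]] := UE t; have [fl fe fa] := hpsi.
have [z zE] : exists z : seq A -> LamE (c t), forall v, psi (z v) = (x v).1 t.
  have zex v : exists z, psi z = (x v).1 t by apply/psiU; have [] := xiP (phi (m v)).
  by have [z zE] := choice zex; exists z.
rewrite -zE -fe; apply: hom_radJ => //.
have gE : good (LamE (c t)) by exact: good_LamE.
apply: (gE k j z kL pj) => //.
have /psi0/(epsJP (is_mod_LamE (c t)))[_ /(_ j pj)] :
    psi (idem j (\sum_(v <- words A k) pathact v (z v))) = 0.
  rewrite fe (islin_sum fl) -[RHS](y0 t tts); congr (idem j _).
  by apply: eq_bigr => v _; rewrite (hom_path _ _ hpsi) zE.
by rewrite (idem_id (is_mod_LamE (c t))).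
Qed.

End Modules.

Local Close Scope ring_scope.

Theorem theorem3p1 (K : fieldType) (n : nat) (A : finType)
  (src tgt : A -> 'I_n) (L : nat) (hL : 1 <= L)
  (M : modData K n A) (hM : is_mod K n A src tgt L M) :
  (fin_pd K n A src tgt L M <-> dsum_copies K n A src tgt L M) /\
  (dsum_copies K n A src tgt L M <-> kernel_nonprecyclic K n A src tgt L M).
Proof.
have good_kernel := good_kernel_nonprecyclic hM.
have kernel_pd := kernel_nonprecyclic_fin_pd hM.
have pd_good := fin_pd_good hM.
have good_dsum := good_dsum_copies hM; have dsum_good := dsum_copies_good hM.
by split; split; auto.
Qed.
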